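(* Let $n\ge1$, let $a_1,\dots,a_n>0$ with $a_j\neq1$ for all $j$, and let $v$ denote the number of distinct values in the set $\{a_1,\dots,a_n\}$. Let $f:\mathbb{R}^n\to\mathbb{R}$ be mixed homogeneous of degree $(a_1,\dots,a_n)$, and let $g$ be a nonnegative locally integrable function on $\mathbb{R}^n$ that is mixed homogeneous of degree $(\rho a_1,\dots,\rho a_n)$ on $\mathbb{R}^n\setminus\{0\}$ for some $\rho\in\mathbb{R}$. For $\phi$ admissible for $g$ (as defined in the context) let $$T(\lambda_0,\lambda_1,\dots,\lambda_n)=\int_{\mathbb{R}^n}e^{i\lambda_0 f(x_1,\dots,x_n)+i\lambda_1x_1+\dots+i\lambda_nx_n}\,\phi(x_1,\dots,x_n)\,dx_1\cdots dx_n .$$ Let $\mu_g$ denote the measure $|g(x_1,\dots,x_n)|\,dx_1\cdots dx_n$. Constants below depend only on the objects in their subscripts (and on $n$, $i$, $a_1,\dots,a_n$, $\rho$), not on the admissible $\phi$ or on $\lambda\in\mathbb{R}^{n+1}$. Suppose the index $i\in\{1,\dots,n\}$ is such that $a_j\neq a_i$ for all $j\neq i$. Suppose $\epsilon_i>0$ is such that for some $D_{f,g,\epsilon_i}>0$, for all $t>0$ one has $\mu_g(\{x\in[-1,1]^n:|x_i|<t\})\le D_{f,g,\epsilon_i}t^{\epsilon_i}$. (a) If $\epsilon_i\neq\frac1{v+1}$, there exists $E_{f,g,\epsilon_i}>0$ such that for all admissible $\phi$ and all $\lambda$, $$|T(\lambda_0,\lambda_1,\dots,\lambda_n)|\le E_{f,g,\epsilon_i}(1+|\lambda_i|)^{-\min(\epsilon_i,\frac1{v+1})}.$$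 If $\epsilon_i=\frac1{v+1}$, this holds with an additional factor of $\ln(2+|\lambda_i|)$ on the right. (b) If $\epsilon_i\neq\frac1v$, there exists $F_{f,g,\epsilon_i}>0$ such that for all admissible $\phi$ and all $(\lambda_1,\dots,\lambda_n)$, $$|T(0,\lambda_1,\dots,\lambda_n)|\le F_{f,g,\epsilon_i}(1+|\lambda_i|)^{-\min(\epsilon_i,\frac1v)}.$$ If $\epsilon_i=\frac1v$, this holds with an additional factor of $\ln(2+|\lambda_i|)$ on the right. (c) If $0<\eta<1$ is such that for all admissible $\phi$ one has an estimate $$|T(0,\lambda_1,\dots,\lambda_n)|\le F_{f,g,\eta}(1+|\lambda_i|)^{-\eta}\quad\text{for all }(\lambda_1,\dots,\lambda_n),$$ then for every $0<\epsilon<\eta$ there is a constant $E_{f,g,\epsilon}$ such that for all $t>0$ $$\mu_g(\{x\in[-1,1]^n:|x_i|<t\})\le E_{f,g,\epsilon}\,t^{\epsilon}.$$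
   Context: Mixed homogeneity: for positive $a_1,\dots,a_n$, a function $f:\mathbb{R}^n\to\mathbb{R}$ is mixed homogeneous of degree $(a_1,\dots,a_n)$ if $f(t^{1/a_1}x_1,\dots,t^{1/a_n}x_n)=t\,f(x_1,\dots,x_n)$ for all $t>0$ and all $x\in\mathbb{R}^n$; $f$ is understood to be Lebesgue measurable. For $\rho\in\mathbb{R}$ (possibly zero or negative), $g$ is mixed homogeneous of degree $(\rho a_1,\dots,\rho a_n)$ on $\mathbb{R}^n\setminus\{0\}$ if $g(t^{1/a_1}x_1,\dots,t^{1/a_n}x_n)=t^{\rho}g(x_1,\dots,x_n)$ for all $t>0$ and $x\neq0$. Admissible $\phi$: an integrable (real- or complex-valued) function $\phi$ on $\mathbb{R}^n$ supported on the unit ball such that $$|\phi(x)|\le g(x)\quad\text{and}\quad\Big|\sum_{j=1}^n\frac{x_j}{a_j}\frac{\partial\phi}{\partial x_j}(x)\Big|\le g(x)$$ for $x\ne 0$. No regularity of $f,g,\phi$ is assumed in directions other than along the curves $t\mapsto(t^{1/a_1}x_1,\dots,t^{1/a_n}x_n)$: the sum $\sum_j\frac{x_j}{a_j}\frac{\partial\phi}{\partial x_j}(x)$ is understood as $\frac{d}{dt}\big|_{t=1}\phi(t^{1/a_1}x_1,\dots,t^{1/a_n}x_n)$, where $t\mapsto\phi(t^{1/a_1}x_1,\dots,t^{1/a_n}x_n)$ is $C^1$ on $(0,\infty)$ for each $x\neq0$. *)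

(* Defs.v *)
From HB Require Import structures.
From mathcomp Require Import all_boot all_order all_algebra.
From mathcomp Require Import all_classical all_reals all_analysis.
From mathcomp Require Import complex.

Set Implicit Arguments.
Unset Strict Implicit.
Unset Printing Implicit Defensive.

Import Order.TTheory GRing.Theory Num.Theory.
Import numFieldNormedType.Exports.

Local Open Scope classical_set_scope.
Local Open Scope ring_scope.
Local Open Scope complex_scope.

Section borel_leb.
Variable R : realType.

Definition consT (n : nat) (p : R * n.-tuple R) : n.+1.-tuple R :=
  [tuple of p.1 :: p.2].

(* Lebesgue measure on the product sigma-algebra of R^n, as an iterated
   product measure. *)
Fixpoint borel_leb (n : nat) : set (n.-tuple R) -> \bar R :=
  match n with
  | 0 => \d_([tuple] : 0.-tuple R)
  | m.+1 => pushforward (@lebesgue_measure R \x borel_leb (n := m))%E (@consT m)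
  end.

Lemma measurable_consT n : measurable_fun [set: R * n.-tuple R] (@consT n).
Proof. exact: measurable_cons. Qed.

Section step.
Variables (n : nat) (m : {sigma_finite_measure set (n.-tuple R) -> \bar R}).

Definition leb_step : set (n.+1.-tuple R) -> \bar R :=
  pushforward (@lebesgue_measure R \x m)%E (@consT n).

Let leb_step0 : leb_step set0 = 0%E.
Proof. by rewrite /leb_step /pushforward preimage_set0 measure0. Qed.

Let leb_step_ge0 A : (0 <= leb_step A)%E.
Proof. exact: (measure_ge0 (@lebesgue_measure R \x m)%E). Qed.

Let leb_step_sigma_additive : semi_sigma_additive leb_step.
Proof.
have := @measure_semi_sigma_additive _ _ _
  (measure_function_pushforward__canonical__measure_function_Measure
     (@lebesgue_measure R \x m)%E (@measurable_consT n)).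
exact.
Qed.

HB.instance Definition _ := isMeasure.Build _ _ _ leb_step
  leb_step0 leb_step_ge0 leb_step_sigma_additive.

Let leb_step_sigma_finite : sigma_finite setT leb_step.
Proof.
have /sigma_finiteP[F [TF ndF Foo]] := sigma_finiteT (@lebesgue_measure R).
have /sigma_finiteP[G [TG ndG Goo]] := sigma_finiteT m.
pose H k := F k `*` G k.
have HT : [set: R * n.-tuple R] = \bigcup_k H k.
  rewrite -setXTT TF TG predeqE => -[x y]; split.
    move=> [/= [i _ Fix] [k _ Gky]]; exists (maxn i k) => //; split.
    - by move: x Fix; exact/subsetPset/ndF/leq_maxl.
    - by move: y Gky; exact/subsetPset/ndG/leq_maxr.
  by move=> [i _ []/= ? ?]; split; exists i.
pose u (x : n.+1.-tuple R) : R * n.-tuple R :=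
  (tnth x ord0, [tuple of behead x]).
have mu_ : measurable_fun [set: n.+1.-tuple R] u.
  apply: measurable_fun_pair; [exact: measurable_tnth|].
  exact: measurable_behead.
exists (fun k => u @^-1` H k).
  by rewrite -preimage_bigcup -HT preimage_setT.
move=> k; have [mF Fk] := Foo k; have [mG Gk] := Goo k; split.
  by rewrite -[X in measurable X]setTI; apply: mu_ => //; exact: measurableX.
rewrite /leb_step /pushforward.
suff -> : @consT n @^-1` (u @^-1` H k) = H k.
  by rewrite product_measure1E// lte_mul_pinfty// ge0_fin_numE.
rewrite -comp_preimage (_ : u \o @consT n = id) ?preimage_id//.
apply/funext => -[x t] /=; rewrite /u /consT /=; congr pair.
exact/val_inj.
Qed.

HB.instance Definition _ := Measure_isSigmaFinite.Build _ _ _ leb_step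
  leb_step_sigma_finite.

End step.

Lemma borel_lebP n : exists m : {sigma_finite_measure set (n.-tuple R) -> \bar R},
  @borel_leb n = m :> (set _ -> \bar R).
Proof.
elim: n => [|n [m IH]]; first by exists (\d_([tuple] : 0.-tuple R)).
by exists (@leb_step n m); rewrite /= IH.
Qed.

Section instance.
Variable n : nat.

Let borel_leb0 : @borel_leb n set0 = 0%E.
Proof. by have [m ->] := borel_lebP n. Qed.

Let borel_leb_ge0 A : (0 <= @borel_leb n A)%E.
Proof. by have [m ->] := borel_lebP n. Qed.

Let borel_leb_sigma_additive : semi_sigma_additive (@borel_leb n).
Proof.
by have [m ->] := borel_lebP n; exact: measure_semi_sigma_additive.
Qed.

HB.instance Definition _ := isMeasure.Build _ _ _ (@borel_leb n)
  borel_leb0 borel_leb_ge0 borel_leb_sigma_additive.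

Let borel_leb_sigma_finite : sigma_finite setT (@borel_leb n).
Proof. by have [m ->] := borel_lebP n; exact: sigma_finiteT. Qed.

HB.instance Definition _ := Measure_isSigmaFinite.Build _ _ _ (@borel_leb n)
  borel_leb_sigma_finite.

End instance.

End borel_leb.

Section definitions.
Variables (R : realType) (n : nat).

(* R^n with the sigma-algebra of Lebesgue measurable sets: those that are
   Caratheodory measurable for the outer measure induced by borel_leb. *)
Definition Rn := caratheodory_type ((@borel_leb R n)^*)%mu.

(* Lebesgue measure on R^n; it is a complete measure. *)
Definition leb : set Rn -> \bar R :=
  @completed_measure_extension _ _ _ (@borel_leb R n).

HB.instance Definition _ := Measure.on leb.

(* tuples carry no topology in the library: compactness is that of the row
   vectors *)
Definition locally_integrable_Rn (g : Rn -> R) : Prop :=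
  measurable_fun [set: Rn] g /\
  forall K : set 'rV[R]_n, compact K ->
    (\int[leb]_(x in [set x : Rn | K (\row_j tnth x j)]) `|g x|%:E < +oo)%E.

Definition origin : Rn := [tuple 0 | j < n].

Definition dil (a : 'I_n -> R) (t : R) (x : Rn) : Rn :=
  [tuple t `^ (a j)^-1 * tnth x j | j < n].

Definition mixed_homogeneous (a : 'I_n -> R) (f : Rn -> R) : Prop :=
  forall (t : R) (x : Rn), 0 < t -> f (dil a t x) = t * f x.

Definition mixed_homogeneous_off0 (a : 'I_n -> R) (rho : R) (g : Rn -> R) :
  Prop :=
  forall (t : R) (x : Rn), 0 < t -> x <> origin ->
    g (dil a t x) = t `^ rho * g x.

Definition cintegrable (h : Rn -> R[i]) : Prop :=
  leb.-integrable [set: Rn] (EFin \o (fun x => complex.Re (h x))) /\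
  leb.-integrable [set: Rn] (EFin \o (fun x => complex.Im (h x))).

Definition cintegral (h : Rn -> R[i]) : R[i] :=
  Rintegral leb [set: Rn] (fun x => complex.Re (h x)) +i*
  Rintegral leb [set: Rn] (fun x => complex.Im (h x)).

Definition cabs (z : R[i]) : R := Normc.normc z.

Definition expi (s : R) : R[i] := cos s +i* sin s.

Definition C1_pos (u : R -> R) : Prop :=
  forall t : R, 0 < t -> derivable u t 1 /\ {for t, continuous (derive1 u)}.

(* sum_j (x_j / a_j) * d phi / d x_j at x, read as the derivative at t = 1 of
   phi along the curve t |-> dil a t x *)
Definition euler_derivative (a : 'I_n -> R) (phi : Rn -> R[i]) (x : Rn) :
  R[i] :=
  derive1 (fun t : R => complex.Re (phi (dil a t x))) 1 +i*
  derive1 (fun t : R => complex.Im (phi (dil a t x))) 1.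

Definition admissible (a : 'I_n -> R) (g : Rn -> R) (phi : Rn -> R[i]) :
  Prop :=
  [/\ cintegrable phi,
      forall x : Rn, 1 < \sum_(j < n) tnth x j ^+ 2 -> phi x = 0,
      forall x : Rn, x <> origin ->
        C1_pos (fun t => complex.Re (phi (dil a t x))) /\
        C1_pos (fun t => complex.Im (phi (dil a t x))) &
      forall x : Rn, x <> origin ->
        cabs (phi x) <= g x /\ cabs (euler_derivative a phi x) <= g x].

Definition osc_integral (f : Rn -> R) (phi : Rn -> R[i]) (lam0 : R) (lam : 'I_n -> R) :
  R[i] :=
  cintegral (fun x =>
    expi (lam0 * f x + \sum_(j < n) lam j * tnth x j) * phi x).

Definition mu_g (g : Rn -> R) (A : set Rn) : \bar R :=
  (\int[leb]_(x in A) `|g x|%:E)%E.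

Definition slab (i : 'I_n) (t : R) : set Rn :=
  [set x : Rn | (forall j, -1 <= tnth x j <= 1) /\ `|tnth x i| < t].

Definition num_distinct (a : 'I_n -> R) : nat :=
  size (undup [seq a j | j <- enum 'I_n]).

End definitions.

(* Main.v *)
(* Averaging T over the dilations x |-> dil a (expR s) x, 0 <= s <= 1, turns it
   into an integral over x of one-dimensional oscillatory integrals whose phase
   is the exponential sum
     lam0 f(x) e^s + sum_j lam_j x_j e^(s / a_j).
   The exponent 1 / a_i occurs only with the coefficient lam_i x_i, so a van der
   Corput estimate of order m (the number of distinct exponents: v + 1, or v if
   lam0 = 0) bounds the inner integral by C g(x) min(1, |lam_i x_i|^(-1/m)), and
   a dyadic decomposition in |x_i| yields (a) and (b).  For (c), take
   phi = c g(x) max(0, 1 - |x|^2)^2: integrating the Fejer-type kernel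
     sum_{j,k < N} cos((j - k) x_i) >= N^2 / 4  for |x_i| <= 1 / (2 N)
   against phi bounds the mass of the slab inside a ball, and homogeneity
   transfers the bound to the cube.  The s-average is a limit of Riemann sums, so
   no joint measurability in (s, x) is needed. *)
Require Import Defs.
From mathcomp Require Import all_boot all_order all_algebra.
From mathcomp Require Import all_classical all_reals all_analysis.
From mathcomp Require Import complex.
From mathcomp Require Import measurable_realfun ring lra.

Set Implicit Arguments.
Unset Strict Implicit.
Unset Printing Implicit Defensive.

Import Order.TTheory GRing.Theory Num.Theory.
Import numFieldNormedType.Exports.

Local Open Scope classical_set_scope.
Local Open Scope ring_scope.
Local Open Scope complex_scope.

(** * Dilations and Lebesgue measure *)

(** Nothing is assumed about [f], [g] and [phi] across dilation orbits, so the dilation parameter is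
    the only variable in which oscillation can be exploited; taking s >= 0 keeps the dilated
    amplitudes supported in the cube. The coefficients other than lam_i x_i vary with x and lambda
    without any control. The van der Corput chain therefore replaces derivatives of the phase by the
    operators d/ds - beta, each of which removes one unwanted exponent whatever its coefficient.
    What remains is a nonzero multiple of lam_i x_i e^(s / a_i), because 1 / a_i differs from 1 and
    from every other 1 / a_j. Each removal costs one further root, whence the dependence of the rate
    on the number of distinct exponents. The logarithm appears when slab mass and decay balance, for
    then all dyadic pieces contribute equally. In (c) the factor g is harmless because along an
    orbit it is a constant times a power of t. *)

Lemma lebesgue_measure_scale (R : realType) (r : R) (A : set R) :
  0 < r -> measurable A ->
  lebesgue_measure (( *%R r) @^-1` A) = ((r^-1)%:E * lebesgue_measure A)%E.
Proof.
move=> r0 mA.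
have mr : measurable_fun [set: measurableTypeR R]
    (( *%R r) : measurableTypeR R -> measurableTypeR R).
  by apply: (@measurable_funM _ _ _ _ (cst r) id) => //; exact: measurable_cst.
pose nu := mscale (NngNum (ltW r0)) (pushforward (@lebesgue_measure R)
  (( *%R r) : measurableTypeR R -> measurableTypeR R)).
pose m : {measure set (measurableTypeR R) -> \bar R} :=
  mscale (NngNum (ltW r0))
   (measure_function_pushforward__canonical__measure_function_Measure
      (@lebesgue_measure R) mr).
suff /(_ A mA) -> : forall B, measurable B -> lebesgue_measure B = m B.
  rewrite /m /= /mscale /= muleA -EFinM mulVf ?gt_eqF// mul1e.
  by [].
apply: lebesgue_measure_unique => _ [[a b] /= _ <-].
rewrite /m /= /mscale /= /pushforward.
rewrite (_ : _ @^-1` _ = `]r^-1 * a, r^-1 * b]%classic); last first.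
  apply/seteqP; split => x /=; rewrite !in_itv /= ![r^-1 * _]mulrC.
    by rewrite ltr_pdivrMr// ler_pdivlMr// ![x * r]mulrC.
  by rewrite ltr_pdivrMr// ler_pdivlMr// ![x * r]mulrC.
rewrite !lebesgue_measure_itv /= !lte_fin ltr_pM2l ?invr_gt0//.
case: ifP => _; last by rewrite mule0.
by rewrite -!EFinD -EFinM -mulrBr mulVKf ?gt_eqF.
Qed.

Definition tscale (R : realType) n (r : 'I_n -> R) (x : n.-tuple R) :
    n.-tuple R := [tuple r j * tnth x j | j < n].

Lemma measurable_tscale (R : realType) n (r : 'I_n -> R) :
  measurable_fun [set: n.-tuple R] (tscale r).
Proof.
apply/measurable_fun_tnthP => j /=.
have -> : (fun x => tnth x j) \o tscale r = (fun x : n.-tuple R => r j * tnth x j).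
  by apply/funext => x /=; rewrite tnth_mktuple.
apply: measurable_funM; first exact: measurable_cst.
exact: measurable_tnth.
Qed.

Lemma tscale_cons (R : realType) n (r : 'I_n.+1 -> R) (p : R * n.-tuple R) :
  tscale r (consT p) =
  consT (r ord0 * p.1, tscale (fun j => r (lift ord0 j)) p.2).
Proof.
apply: eq_from_tnth => j; rewrite tnth_mktuple.
case: (unliftP ord0 j) => [k ->|->]; last by rewrite !tnth0.
by rewrite !tnthS tnth_mktuple.
Qed.

Lemma borel_leb_tscale (R : realType) n (r : 'I_n -> R) (A : set (n.-tuple R)) :
  (forall j, 0 < r j) -> measurable A ->
  borel_leb (tscale r @^-1` A) = ((\prod_j r j)^-1%:E * borel_leb A)%E.
Proof.
elim: n r A => [|n IH] r A r0 mA.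
  rewrite big_ord0 invr1 mul1e /=; congr (\d_ _ _).
  apply/seteqP; split => x /=; by rewrite (tuple0 x) (tuple0 (tscale _ _)).
set r' := fun j : 'I_n => r (lift ord0 j).
have r'0 j : 0 < r' j by exact: r0.
have P0 : 0 < \prod_j r j by apply: prodr_gt0.
have P'0 : 0 < \prod_j r' j by apply: prodr_gt0.
pose S (p : measurableTypeR R * n.-tuple R) : measurableTypeR R * n.-tuple R :=
  (r ord0 * p.1, tscale r' p.2).
have mS : measurable_fun setT S.
  apply: measurable_fun_pair => /=.
    apply: measurable_funM; first exact: measurable_cst.
    exact: measurable_fst.
  apply: measurableT_comp; first exact: measurable_tscale.
  exact: measurable_snd.
pose m : {measure set (measurableTypeR R * n.-tuple R) -> \bar R} :=
  mscale (NngNum (ltW P0))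
   (measure_function_pushforward__canonical__measure_function_Measure
      (@lebesgue_measure R \x @borel_leb R n)%E mS).
rewrite /=.
have mE : forall X, measurable X ->
    (@lebesgue_measure R \x @borel_leb R n)%E X = m X.
  apply: product_measure_unique => B C mB mC.
  rewrite /m /= /mscale /= /pushforward.
  rewrite (_ : _ @^-1` _ = ( *%R (r ord0) @^-1` B) `*` (tscale r' @^-1` C)); last first.
    by [].
  rewrite product_measure1E; last 2 first.
  - rewrite -[X in measurable X]setTI.
    by apply: (@measurable_funM _ _ _ _ (cst _) id) => //; exact: measurable_cst.
  - rewrite -[X in measurable X]setTI.
    by apply: measurable_tscale.
  transitivity ((\prod_j r j)%:E * (((r ord0)^-1%:E * lebesgue_measure B) *
      ((\prod_j r' j)^-1%:E * borel_leb C)))%E.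
    by congr (_ * (_ * _))%E; [exact: lebesgue_measure_scale|exact: IH].
  rewrite muleACA -EFinM.
  have E : \prod_j r j = r ord0 * \prod_j r' j by rewrite big_ord_recl.
  rewrite -invfM -E.
  by rewrite [LHS]muleA -EFinM divff ?mul1e// gt_eqF.
have mc : forall B : set (n.+1.-tuple R), measurable B ->
    measurable (@consT R n @^-1` B).
  by move=> B mB; rewrite -[X in measurable X]setTI; exact: measurable_consT.
rewrite /pushforward [in RHS]mE; last exact: mc.
rewrite /m /= /mscale /= [RHS]muleA -EFinM mulVf ?gt_eqF// mul1e /pushforward.
congr (product_measure1 _ _ _).
by apply/seteqP; split => p /=; rewrite tscale_cons.
Qed.

Lemma tscaleK (R : realType) n (r : 'I_n -> R) : (forall j, 0 < r j) ->
  cancel (tscale r) (tscale (fun j => (r j)^-1)).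
Proof.
move=> r0 x; apply: eq_from_tnth => j.
by rewrite !tnth_mktuple mulrA mulVf ?mul1r// gt_eqF.
Qed.

Lemma tscaleVK (R : realType) n (r : 'I_n -> R) : (forall j, 0 < r j) ->
  cancel (tscale (fun j => (r j)^-1)) (tscale r).
Proof.
move=> r0 x; apply: eq_from_tnth => j.
by rewrite !tnth_mktuple mulrA mulfV ?mul1r// gt_eqF.
Qed.

(** Borel covers of [X] pull back to covers of its preimage, with measures scaled by the Jacobian.
    Working with the outer measure gives the bound for every set [X], as the Caratheodory condition
    requires. *)
Lemma leb_tscale_le (R : realType) n (r : 'I_n -> R) (X : set (Rn R n)) :
  (forall j, 0 < r j) ->
  (leb (tscale r @^-1` X) <= (\prod_j r j)^-1%:E * leb X)%E.
Proof.
move=> r0; have P0 : 0 < \prod_j r j by apply: prodr_gt0.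
have Q0 : 0 < (\prod_j r j)^-1 by rewrite invr_gt0.
rewrite lee_pdivlMl//.
rewrite {2}/leb /completed_measure_extension /mu_ext.
apply: le_ereal_inf_tmp => _ [A [mA XA] <-].
rewrite -lee_pdivlMl// -nneseriesZl//.
rewrite (eq_eseriesr (g := fun k => borel_leb (tscale r @^-1` A k))); last first.
  by move=> k _; rewrite borel_leb_tscale.
rewrite /leb /completed_measure_extension /mu_ext.
apply: ereal_inf_lbound => /=; exists (fun k => tscale r @^-1` A k) => //; split.
  move=> k; rewrite -[X in measurable X]setTI; exact: measurable_tscale.
by move=> x /= /XA [k _ Ak]; exists k.
Qed.

Lemma leb_tscale (R : realType) n (r : 'I_n -> R) (X : set (Rn R n)) :
  (forall j, 0 < r j) ->
  leb (tscale r @^-1` X) = ((\prod_j r j)^-1%:E * leb X)%E.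
Proof.
move=> r0; apply/eqP; rewrite eq_le leb_tscale_le//=.
have P0 : 0 < \prod_j r j by apply: prodr_gt0.
rewrite lee_pdivrMl//.
have := @leb_tscale_le R n (fun j => (r j)^-1) (tscale r @^-1` X).
rewrite -comp_preimage (_ : tscale r \o _ = id) ?preimage_id; last first.
  by apply/funext => x /=; rewrite tscaleVK.
rewrite prodfV invrK; apply => j; by rewrite invr_gt0.
Qed.

Lemma measurable_tscale_Rn (R : realType) n (r : 'I_n -> R) :
  (forall j, 0 < r j) ->
  measurable_fun [set: Rn R n] (tscale r : Rn R n -> Rn R n).
Proof.
move=> r0 _ A mA; rewrite setTI.
suff : caratheodory_measurable (mu_ext (@borel_leb R n)) (tscale r @^-1` A) by [].
move=> X.
(* By bijectivity every test set is a preimage, so the splitting condition for the preimage of [A]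
   is that of [A] multiplied by the Jacobian factor. *)
have [Y ->] : exists Y, X = tscale r @^-1` Y.
  exists (tscale (fun j => (r j)^-1) @^-1` X).
  by apply/seteqP; split => x /=; rewrite tscaleK.
have P0 : 0 < \prod_j r j by apply: prodr_gt0.
transitivity (leb (tscale r @^-1` Y)) => //.
transitivity (leb (tscale r @^-1` (Y `&` A)) + leb (tscale r @^-1` (Y `&` ~` A)))%E => //.
rewrite !leb_tscale// -ge0_muleDr ?measure_ge0//.
  congr (_ * _)%E; exact: mA.
Qed.

Lemma measurable_tnth_Rn (R : realType) n (j : 'I_n) :
  measurable_fun [set: Rn R n] ((fun x => tnth x j) : Rn R n -> R).
Proof.
move=> _ A mA; apply: caratheodory_measurable_mu_ext.
exact: measurable_tnth.
Qed.

Lemma ge0_integral_tscale (R : realType) n (r : 'I_n -> R)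
    (h : Rn R n -> \bar R) :
  (forall j, 0 < r j) -> measurable_fun setT h -> (forall x, 0 <= h x)%E ->
  (\int[@leb R n]_x h x = (\prod_j r j)%:E * \int[@leb R n]_x h (tscale r x))%E.
Proof.
move=> r0 mh h0; have P0 : 0 < \prod_j r j by apply: prodr_gt0.
have mS := measurable_tscale_Rn r0.
have mhS : measurable_fun setT (fun x : Rn R n => h (tscale r x)).
  exact: (measurableT_comp mh mS).
pose m1 : {measure set (Rn R n) -> \bar R} :=
  mscale (NngNum (ltW P0))
    (measure_function_pushforward__canonical__measure_function_Measure
       (@leb R n) mS).
transitivity (\int[m1]_x h x)%E.
  apply: eq_measure_integral => A mA _.
  rewrite /m1 /= /mscale /= /pushforward leb_tscale// muleA -EFinM divff ?mul1e//.
  by rewrite gt_eqF.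
rewrite ge0_integral_mscale//; congr (_ * _)%E.
by rewrite ge0_integral_pushforward.
Qed.

Lemma integrable_tscale (R : realType) n (r : 'I_n -> R) (h : Rn R n -> R) :
  (forall j, 0 < r j) -> (@leb R n).-integrable setT (EFin \o h) ->
  (@leb R n).-integrable setT (EFin \o (fun x : Rn R n => h (tscale r x))).
Proof.
move=> r0 /integrableP[mh hoo].
have P0 : 0 < \prod_j r j by apply: prodr_gt0.
have mS := measurable_tscale_Rn r0.
apply/integrableP; split; first exact: (measurableT_comp mh mS).
move: hoo; rewrite (ge0_integral_tscale r0); last 2 first.
- exact: measurableT_comp.
- by move=> x.
by rewrite -lte_pdivlMl// => /lt_le_trans; apply; exact: leey.
Qed.

Lemma Rintegral_tscale (R : realType) n (r : 'I_n -> R) (h : Rn R n -> R) :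
  (forall j, 0 < r j) -> (@leb R n).-integrable setT (EFin \o h) ->
  Rintegral (@leb R n) setT h =
  \prod_j r j * Rintegral (@leb R n) setT (fun x => h (tscale r x)).
Proof.
move=> r0 ih; have ihS := integrable_tscale r0 ih.
have P0 : 0 < \prod_j r j by apply: prodr_gt0.
rewrite /Rintegral -[X in X * _]/(fine (\prod_j r j)%:E) -fineM//; last first.
  exact: integrable_fin_num.
congr fine.
have mh := measurable_int _ ih.
have E1 := ge0_integral_tscale r0 (measurable_funepos mh) (fun=> funepos_ge0 _ _).
have E2 := ge0_integral_tscale r0 (measurable_funeneg mh) (fun=> funeneg_ge0 _ _).
rewrite [LHS]integralE E1 E2 [X in (_ = _ * X)%E]integralE; apply/esym.
set I1 := integral _ _ _; set I2 := integral _ _ _.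
rewrite (@muleBr R _ I1 I2)//; first by congr (_ * _ - _ * _)%E;
  apply: eq_integral => x _; rewrite ?funeposE ?funenegE.
by apply: fin_num_adde_defl; rewrite fin_numN /I2 integrable_neg_fin_num.
Qed.

(** This null hyperplane contains the origin, the one point at which [mixed_homogeneous_off0] and
    the bounds of [admissible] say nothing. *)
Lemma leb_hyperplane (R : realType) n : (1 <= n)%N ->
  exists j : 'I_n, leb [set x : Rn R n | tnth x j = 0] = 0.
Proof.
case: n => // n _; exists ord0.
rewrite /leb /completed_measure_extension.
have m0 : measurable [set x : n.+1.-tuple R | tnth x ord0 = 0].
  rewrite -[X in measurable X]setTI.
  apply: (@measurable_tnth _ R n.+1 ord0 measurableT [set 0]).
  exact: measurable_set1.
rewrite measurable_mu_extE//= /pushforward.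
rewrite (_ : _ @^-1` _ = [set 0] `*` setT); last first.
  by apply/seteqP; split => -[x y] /=; rewrite tnth0 => // -[].
rewrite product_measure1E//.
rewrite [X in (X * _)%E](_ : _ = 0%E) ?mul0e//.
exact: lebesgue_measure_set1.
Qed.

Lemma ge0_integralZl_real (R : realType) n (A : set (Rn R n)) (h : Rn R n -> R)
    (k : R) :
  measurable A -> measurable_fun setT h -> (forall x, 0 <= h x) -> 0 <= k ->
  (\int[@leb R n]_(x in A) (k%:E * (h x)%:E) =
   k%:E * \int[@leb R n]_(x in A) (h x)%:E)%E.
Proof.
move=> mA mh h0 k0; apply: ge0_integralZl_EFin.
- exact: mA.
- by move=> x _; rewrite lee_fin.
- by apply/measurable_EFinP; exact: measurable_funTS.
- exact: k0.
Qed.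

Definition cube (R : realType) n : set (Rn R n) :=
  [set x | forall j, -1 <= tnth x j <= 1].

Lemma measurable_cube (R : realType) n : measurable (@cube R n).
Proof.
rewrite (_ : @cube R n = \bigcap_(j in [set: 'I_n])
   ((fun x : Rn R n => tnth x j) @^-1` `[-1, 1])).
  apply: fin_bigcap_measurable => // j _.
  rewrite -[X in measurable X]setTI.
  by apply: measurable_tnth_Rn => //; exact: measurable_itv.
apply/seteqP; split => x /= H j; last by have := H j I; rewrite /= in_itv.
by move=> _; rewrite /= in_itv; exact: H.
Qed.

Lemma mu_cube_lty (R : realType) n (g : Rn R n -> R) :
  locally_integrable_Rn g -> (mu_g g (@cube R n) < +oo)%E.
Proof.
move=> [mg] /(_ [set v : 'rV[R]_n | forall j, `[-1, 1]%classic (v ord0 j)]).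
rewrite /mu_g.
rewrite (_ : [set x | _] = @cube R n); last first.
  apply/seteqP; split => x /= H j.
    by have := H j; rewrite /= mxE in_itv.
  by rewrite /= mxE in_itv; exact: H.
apply.
apply: (@rV_compact R n (fun=> `[-1, 1]%classic)) => j.
exact: segment_compact.
Qed.

Lemma mu_cube_integrable (R : realType) n (g : Rn R n -> R) :
  locally_integrable_Rn g -> (@leb R n).-integrable (@cube R n) (EFin \o g).
Proof.
move=> lg; apply/integrableP; split; last exact: (mu_cube_lty lg).
by apply/measurable_EFinP; apply: measurable_funTS; exact: lg.1.
Qed.

(** * Van der Corput estimates for exponential sums *)

Section derive_real.
Variable R : realType.
Implicit Types f g : R -> R.

Lemma is_derive1D f g (x df dg : R) :
  is_derive x 1 f df -> is_derive x 1 g dg ->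
  is_derive x 1 (fun s => f s + g s) (df + dg).
Proof. by move=> hf hg; exact: is_deriveD. Qed.

Lemma is_derive1M f g (x df dg : R) :
  is_derive x 1 f df -> is_derive x 1 g dg ->
  is_derive x 1 (fun s => f s * g s) (df * g x + f x * dg).
Proof.
move=> hf hg; have := is_deriveM hf hg; rewrite /GRing.scale/= => h.
by apply: is_derive_eq h _; rewrite addrC mulrC [X in _ + X]mulrC; ring.
Qed.

Lemma is_derive1Z f (k x df : R) :
  is_derive x 1 f df -> is_derive x 1 (fun s => k * f s) (k * df).
Proof. by move=> hf; exact: is_deriveZ. Qed.

Lemma is_derive1V f (x df : R) : f x != 0 ->
  is_derive x 1 f df -> is_derive x 1 (fun s => (f s)^-1) (- df / f x ^+ 2).
Proof.
move=> f0 hf; have := @is_deriveV R f x df 1 f0 hf.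
by move=> h; apply: is_derive_eq h _; rewrite /GRing.scale/= ; field.
Qed.

Lemma is_derive1_sin f (x df : R) :
  is_derive x 1 f df -> is_derive x 1 (fun s => sin (f s)) (cos (f x) * df).
Proof. by move=> hf; apply: is_derive_eq; rewrite /GRing.scale/= mulrC. Qed.

Lemma is_derive1_cos f (x df : R) :
  is_derive x 1 f df -> is_derive x 1 (fun s => cos (f s)) (- sin (f x) * df).
Proof. by move=> hf; apply: is_derive_eq; rewrite /GRing.scale/= mulrC. Qed.

Lemma is_derive1_expR f (x df : R) :
  is_derive x 1 f df -> is_derive x 1 (fun s => expR (f s)) (expR (f x) * df).
Proof. by move=> hf; apply: is_derive_eq; rewrite /GRing.scale/= mulrC. Qed.

Lemma is_derive_continuous_within f df (a b : R) :
  (forall s, a <= s <= b -> is_derive s 1 f (df s)) ->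
  {within `[a, b], continuous f}.
Proof.
move=> h; apply: derivable_within_continuous => s; rewrite in_itv/= => sab.
by have := h s sab => -[].
Qed.

Lemma MVT_real f df (a b : R) : a <= b ->
  (forall s, a <= s <= b -> is_derive s 1 f (df s)) ->
  exists2 c, a <= c <= b & f b - f a = df c * (b - a).
Proof.
move=> ab h; have [||c] := @MVT_segment R f df a b ab.
- by move=> x; rewrite in_itv/= => /andP[/ltW ax /ltW xb]; apply: h; rewrite ax.
- exact: is_derive_continuous_within h.
by rewrite in_itv/= => ? ?; exists c.
Qed.

(** The mean value theorem for [g - f] and [g + f]. Van der Corput's integration by parts is run
    through this comparison, with antiderivatives in place of integrals. *)
Lemma derive_dominated f g df dg (a b : R) : a <= b ->
  (forall s, a <= s <= b -> is_derive s 1 f (df s)) ->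
  (forall s, a <= s <= b -> is_derive s 1 g (dg s)) ->
  (forall s, a <= s <= b -> `|df s| <= dg s) ->
  `|f b - f a| <= g b - g a.
Proof.
move=> ab hf hg dfg.
have H (e : R) : `|e| = 1 -> e * (f b - f a) <= g b - g a.
  move=> e1.
  have [|c cab E] := @MVT_real (fun s => g s + (- e) * f s)
      (fun s => dg s + (- e) * df s) a b ab.
    move=> s sab; apply: is_derive1D; first exact: hg.
    by apply: is_derive1Z; exact: hf.
  have : 0 <= (dg c + - e * df c) * (b - a).
    rewrite mulr_ge0// ?subr_ge0// mulNr subr_ge0.
    by rewrite (le_trans _ (dfg c cab))// (le_trans (ler_norm _))// normrM e1 mul1r.
  by rewrite -E; lra.
rewrite ler_norml; apply/andP; split.
  by have := H (-1); rewrite normrN1 => /(_ erefl); lra.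
by have := H 1; rewrite normr1 => /(_ erefl); lra.
Qed.

End derive_real.

Section van_der_corput.
Variable R : realType.

(* [Phi] plays the role of the integral of [cos P * psi]; it is compared with the
   integrated-by-parts main term [sin P * psi / u0], the constant sign of [u1]
   controlling the variation of [1 / u0]. *)
Lemma vdc_first (P u0 u1 psi dpsi Phi : R -> R) (beta A b mu a c : R) :
  a <= c -> c - a <= 1 -> 0 < mu -> `|beta| <= b ->
  (forall s : R, is_derive s 1 P (u0 s)) ->
  (forall s : R, is_derive s 1 u0 (beta * u0 s + u1 s)) ->
  (forall s, a <= s <= c -> is_derive s 1 psi (dpsi s)) ->
  (forall s, a <= s <= c -> is_derive s 1 Phi (cos (P s) * psi s)) ->
  (forall s, a <= s <= c -> `|psi s| <= A) ->
  (forall s, a <= s <= c -> `|dpsi s| <= A) ->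
  (forall s, a <= s <= c -> mu <= `|u0 s|) ->
  (forall s, a <= s <= c -> 0 <= u1 s) \/ (forall s, a <= s <= c -> u1 s <= 0) ->
  `|Phi c - Phi a| <= A * (5 + 2 * b) / mu.
Proof.
move=> ac ca1 mu0 beb dP du dpsiE dPhi psiA dpsiA u0mu u1s.
have u0N s : a <= s <= c -> u0 s != 0.
  by move=> /u0mu H; rewrite -normr_gt0 (lt_le_trans mu0).
have A0 : 0 <= A by rewrite (le_trans _ (psiA a _))// lexx.
have b0 : 0 <= b by rewrite (le_trans _ beb).
have iu0 s : a <= s <= c -> `|(u0 s)^-1| <= mu^-1.
  move=> sac; rewrite normfV lef_pV2 ?posrE ?normr_gt0 ?u0N//.
  exact: u0mu.
have [e e1 eu1] : exists2 e : R, `|e| = 1 &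
    forall s, a <= s <= c -> `|u1 s| = e * u1 s.
  case: u1s => H; [exists 1|exists (-1)]; rewrite ?normrN1 ?normr1// => s sac.
    by rewrite ger0_norm ?H// mul1r.
  by rewrite ler0_norm ?H// mulN1r.
have B s : `|sin s| <= 1 :> R.
  by rewrite ler_norml sin_geN1 sin_le1.
pose F s := sin (P s) * psi s * (u0 s)^-1.
(* The derivative of [N] dominates that of [F - Phi]. The last term of [N] contributes A |u1| /
   u0^2, which matches the variation of 1 / u0. In the linear term, 1 + b bounds the [dpsi] and
   [beta] terms of [F], and the second b absorbs the [beta] part of the derivative of that last
   term. *)
pose N s := A * (1 + 2 * b) / mu * s + (- (e * A)) * (u0 s)^-1.
pose dF s := (cos (P s) * u0 s * psi s + sin (P s) * dpsi s) * (u0 s)^-1 +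
   sin (P s) * psi s * (- (beta * u0 s + u1 s) / u0 s ^+ 2).
pose dN s := A * (1 + 2 * b) / mu * 1 +
  (- (e * A)) * (- (beta * u0 s + u1 s) / u0 s ^+ 2).
have dFE s : a <= s <= c -> is_derive s 1 F (dF s).
  move=> sac; exact: is_derive1M (is_derive1M (is_derive1_sin (dP s))
    (dpsiE s sac)) (is_derive1V (u0N _ sac) (du s)).
have dNE s : a <= s <= c -> is_derive s 1 N (dN s).
  move=> sac; exact: is_derive1D (is_derive1Z _ (is_derive_id s 1))
    (is_derive1Z _ (is_derive1V (u0N _ sac) (du s))).
have : `|(F c + (-1) * Phi c) - (F a + (-1) * Phi a)| <= N c - N a.
  apply: (@derive_dominated R (fun s => F s + (-1) * Phi s) N
    (fun s => dF s + (-1) * (cos (P s) * psi s)) dN a c ac _ dNE) => [s sac|s sac].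
    exact: is_derive1D (dFE _ sac) (is_derive1Z _ (dPhi _ sac)).
  have -> : dF s + (-1) * (cos (P s) * psi s) =
      sin (P s) * dpsi s * (u0 s)^-1 - sin (P s) * psi s * beta * (u0 s)^-1
      - sin (P s) * psi s * (u1 s * (u0 s)^-1 ^+ 2).
    by rewrite /dF; field; exact: u0N.
  have -> : dN s = A * (1 + 2 * b) / mu + e * A * (beta * (u0 s)^-1) +
      A * ((e * u1 s) * (u0 s)^-1 ^+ 2).
    by rewrite /dN; field; rewrite u0N//= gt_eqF.
  rewrite -eu1//.
  have sb x y : `|x| <= A -> `|y| <= mu^-1 -> `|sin (P s) * x * y| <= A / mu.
    by move=> xA yu; rewrite !normrM ler_pM// ?mulr_ge0// -[A]mul1r ler_pM.
  have H1 := sb _ _ (dpsiA s sac) (iu0 s sac).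
  have H2 : `|sin (P s) * psi s * beta * (u0 s)^-1| <= A / mu * b.
    rewrite -mulrA [beta * _]mulrC mulrA normrM ler_pM//.
    by apply: sb; [exact: psiA|exact: iu0].
  have H3 : `|sin (P s) * psi s * (u1 s * (u0 s)^-1 ^+ 2)| <=
      A * (`|u1 s| * (u0 s)^-1 ^+ 2).
    rewrite normrM ler_pM//.
      by rewrite normrM -[A]mul1r ler_pM// psiA.
    by rewrite normrM [X in _ * X <= _]ger0_norm// sqr_ge0.
  have H4 : - (A / mu * b) <= e * A * (beta * (u0 s)^-1).
    suff : `|e * A * (beta * (u0 s)^-1)| <= A / mu * b.
      by rewrite ler_norml => /andP[].
    rewrite !normrM e1 mul1r (ger0_norm A0) -mulrA ler_wpM2l//.
    by rewrite mulrC ler_pM// iu0.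
  move: H1 H2 H3; set X1 := sin _ * _ * _.
  set X2 := sin _ * _ * _ * _; set X3 := sin _ * _ * _.
  move=> H1 H2 H3; rewrite (le_trans (ler_normB _ _))//.
  apply: (le_trans (lerD (ler_normB _ _) (lexx _))).
  apply: (le_trans (lerD (lerD H1 H2) H3)).
  rewrite lerD2r; move: H4; set Y := e * A * _.
  have -> : A * (1 + 2 * b) / mu = A / mu + 2 * (A / mu * b) by ring.
  by lra.
have aac : a <= a <= c by rewrite lexx.
have cac : a <= c <= c by rewrite lexx ac.
have FA s : a <= s <= c -> `|F s| <= A / mu.
  move=> sac; rewrite /F normrM ler_pM ?iu0//.
  by rewrite normrM -[A]mul1r ler_pM// psiA.
have NA s : a <= s <= c -> `|e * A * (u0 s)^-1| <= A / mu.
  by move=> sac; rewrite !normrM e1 mul1r (ger0_norm A0) ler_wpM2l// iu0.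
have NN : N c - N a <= A * (1 + 2 * b) / mu + 2 * (A / mu).
  rewrite /N; have := NA _ aac; have := NA _ cac; rewrite !ler_norml.
  move=> /andP[h1 h2] /andP[h3 h4].
  have h5 : A * (1 + 2 * b) / mu * (c - a) <= A * (1 + 2 * b) / mu.
    rewrite ler_piMr//; apply: mulr_ge0; last by rewrite invr_ge0 ltW.
    by apply: mulr_ge0 => //; lra.
  rewrite !mulNr; lra.
have := FA _ aac; have := FA _ cac.
rewrite !ler_norml => /andP[h1 h2] /andP[h3 h4] /andP[h5 h6].
(* In units of A / mu, the increment of [N] gives 1 + 2 b + 2, the last 2 from 1 / u0 at the
   endpoints; the boundary values of [F] give another 2. *)
have -> : A * (5 + 2 * b) / mu = A * (1 + 2 * b) / mu + 2 * (A / mu) + 2 * (A / mu).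
  by ring.
by apply/andP; split; lra.
Qed.

(** If [w] keeps one sign, [z] is the endpoint where [|w|] is smallest; otherwise it is a zero of
    [w]. In both cases growth away from [z] gives the linear lower bound. *)
Lemma monotone_zero (w dw : R -> R) (a c mu : R) : a <= c -> 0 <= mu ->
  (forall s, a <= s <= c -> is_derive s 1 w (dw s)) ->
  (forall s, a <= s <= c -> mu <= dw s) ->
  exists2 z, a <= z <= c & forall s, a <= s <= c -> mu * `|s - z| <= `|w s|.
Proof.
move=> ac mu0 wd dwm.
have aac : a <= a <= c by rewrite lexx.
have cac : a <= c <= c by rewrite lexx ac.
have grow s t : a <= s <= c -> a <= t <= c -> s <= t -> mu * (t - s) <= w t - w s.
  move=> /andP[as_ sc] /andP[at_ tc] st.
  have [x /andP[sx xt]|x /andP[sx xt] ->] := @MVT_real R w dw s t st.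
    by apply: wd; rewrite (le_trans as_)// (le_trans xt).
  by rewrite ler_wpM2r ?subr_ge0// dwm// (le_trans as_)// (le_trans xt).
have key z : a <= z <= c -> (z = a /\ 0 <= w z \/ z = c /\ w z <= 0 \/ w z = 0) ->
    exists2 z, a <= z <= c & forall s, a <= s <= c -> mu * `|s - z| <= `|w s|.
  move=> zac zw; exists z => // s sac; have /andP[as_ sc] := sac.
  have [zs|sz] := leP z s.
    rewrite ger0_norm ?subr_ge0//; have := grow _ _ zac sac zs.
    case: zw => [[_ w0]|[[zc w0]|w0]].
    - by move=> h; rewrite (le_trans _ (ler_norm _))//; lra.
    - have -> : s = z by apply/eqP; rewrite eq_le zs zc sc.
      by rewrite subrr mulr0.
    - by rewrite w0 subr0 => h; rewrite (le_trans _ (ler_norm _)).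
  rewrite distrC ger0_norm ?subr_ge0 ?(ltW sz)//; have := grow _ _ sac zac (ltW sz).
  case: zw => [[za w0]|[[_ w0]|w0]].
  - by move: sz; rewrite za ltNge as_.
  - by move=> h; rewrite -normrN (le_trans _ (ler_norm _))//; lra.
  - by rewrite w0 sub0r => h; rewrite -normrN (le_trans _ (ler_norm _)).
have [wa|wa] := leP 0 (w a); first by apply: (key a) => //; left.
have [wc|wc] := leP (w c) 0; first by apply: (key c) => //; right; left.
have [|z] := @IVT R w a c 0 ac (is_derive_continuous_within wd).
  by rewrite ge_min le_max (ltW wa) (ltW wc) orbT.
rewrite in_itv/= => zac wz; apply: (key z) => //; right; right; exact: wz.
Qed.

End van_der_corput.

Section van_der_corput_chain.
Variable R : realType.

Lemma constant_sign (f df : R -> R) (a c mu : R) : a <= c -> 0 < mu ->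
  (forall s, a <= s <= c -> is_derive s 1 f (df s)) ->
  (forall s, a <= s <= c -> mu <= `|f s|) ->
  (forall s, a <= s <= c -> mu <= f s) \/ (forall s, a <= s <= c -> f s <= - mu).
Proof.
move=> ac mu0 fd fmu.
have fn0 s : a <= s <= c -> f s != 0.
  by move=> /fmu H; rewrite -normr_gt0 (lt_le_trans mu0).
have nosw s t : a <= s <= c -> a <= t <= c -> s <= t ->
    ~ (Num.min (f s) (f t) <= 0 <= Num.max (f s) (f t)).
  move=> /andP[as_ sc] /andP[at_ tc] st H.
  have [|z] := @IVT R f s t 0 st _ H.
    apply: (@is_derive_continuous_within _ f df) => x /andP[sx xt]; apply: fd.
    by rewrite (le_trans as_)// (le_trans xt).
  rewrite in_itv/= => /andP[sz zt] fz.
  have : f z != 0 by apply: fn0; rewrite (le_trans as_)// (le_trans zt).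
  by rewrite fz eqxx.
have aac : a <= a <= c by rewrite lexx.
have [fa|fa] := leP 0 (f a); [left|right] => s sac; have := fmu s sac.
  have [f0|f0] := leP 0 (f s); first by rewrite ger0_norm.
  move: (sac) => /andP[as_ _].
  by exfalso; apply: (nosw a s aac sac as_); rewrite ge_min le_max fa (ltW f0) orbT.
have [f0|f0] := leP (f s) 0; first by rewrite ler0_norm//; lra.
move: (sac) => /andP[as_ _].
by exfalso; apply: (nosw a s aac sac as_); rewrite ge_min le_max (ltW fa) (ltW f0) orbT.
Qed.

(** The base value comes from one integration by parts. In the recursive step the first 2 pays for
    the excised window and the second for the two pieces beside it, each with the loss
    [expR (2 * b)] caused by the integrating factor. *)
Fixpoint vdc_const (b : R) (k : nat) : R :=
  if k is k'.+1 then 2 + 2 * vdc_const b k' * expR (2 * b) else 5 + 2 * b.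

Lemma vdc_const_ge0 b k : 0 <= b -> 0 <= vdc_const b k.
Proof.
move=> b0; elim: k => [|k IH] /=; first by lra.
by rewrite addr_ge0// mulr_ge0// ?expR_ge0// mulr_ge0.
Qed.

Lemma powR_expR (x y : R) : 0 < x -> x `^ y = expR (y * ln x).
Proof. by move=> x0; rewrite /powR gt_eqF. Qed.

(** Since (1 - 1 / (k + 2)) / (k + 1) = 1 / (k + 2), a lower bound of order mu * mu^(-1 / (k + 2))
    beside the window yields a contribution of the same order as the length of the window. *)
Lemma vdc_window_exponent (b mu : R) k : 0 <= b -> 0 < mu ->
  (expR (- (2 * b)) * (mu * mu `^ (- k.+2%:R^-1))) `^ (- k.+1%:R^-1) <=
  expR (2 * b) * mu `^ (- k.+2%:R^-1).
Proof.
move=> b0 mu0; have m0 := powR_gt0 (- k.+2%:R^-1) mu0.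
rewrite powR_expR ?mulr_gt0 ?expR_gt0// !lnM ?posrE ?expR_gt0 ?mulr_gt0//.
rewrite !powR_expR// !expRK -expRD ler_expR.
have k1 : (k.+1%:R : R) != 0 by rewrite pnatr_eq0.
have k2 : (k.+2%:R : R) != 0 by rewrite pnatr_eq0.
have -> : - k.+1%:R^-1 * (- (2 * b) + (ln mu + - k.+2%:R^-1 * ln mu)) =
    2 * b * k.+1%:R^-1 + - k.+2%:R^-1 * ln mu :> R.
  have E : (k.+2%:R : R) = k.+1%:R + 1 by rewrite -natr1.
  rewrite E; rewrite E in k2; move: k1 k2; clear E.
  by move: (k.+1%:R) => K k1 k2; field; rewrite k1 k2.
rewrite lerD2r ler_piMr ?mulr_ge0//.
by rewrite invf_le1 ?ltr0n// ler1n.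
Qed.

(** The sequence [u] takes the place of the successive derivatives of the phase: each member arises
    from the previous one by d/ds - beta j, so that a choice of [beta] can annihilate the terms of
    an exponential sum one by one. *)
Variables (P : R -> R) (u : nat -> R -> R) (beta : nat -> R) (b : R).
Hypothesis betab : forall j, `|beta j| <= b.
Hypothesis dP : forall s : R, is_derive s 1 P (u 0%N s).
Hypothesis du : forall j (s : R), is_derive s 1 (u j) (beta j * u j s + u j.+1 s).
Variables (psi dpsi Phi : R -> R) (A : R).
Hypothesis dpsiE : forall s : R, 0 <= s <= 1 -> is_derive s 1 psi (dpsi s).
Hypothesis dPhi : forall s : R, 0 <= s <= 1 -> is_derive s 1 Phi (cos (P s) * psi s).
Hypothesis psiA : forall s : R, 0 <= s <= 1 -> `|psi s| <= A.
Hypothesis dpsiA : forall s : R, 0 <= s <= 1 -> `|dpsi s| <= A.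

Lemma vdc_trivial (p q : R) : 0 <= p -> p <= q -> q <= 1 ->
  `|Phi q - Phi p| <= A * (q - p).
Proof.
move=> p0 pq q1.
have sub s : p <= s <= q -> 0 <= s <= 1.
  by move=> /andP[ps sq]; rewrite (le_trans p0)// (le_trans sq).
rewrite mulrBr; apply: (@derive_dominated R Phi (fun s => A * s)
  (fun s => cos (P s) * psi s) (fun=> A * 1) p q pq) => s /sub s01.
  exact: dPhi.
rewrite normrM mulrC ler_pM// ?psiA//.
by rewrite ler_norml cos_geN1 cos_le1.
Qed.

(* Cutting out the window of length [2 d] around the near-zero [z] of [u k] costs
   [2 d A]; outside it [u k] is at least of order [mu * d], and [d] is chosen so
   that the two contributions balance. *)
Lemma vdc_chain k (a c mu : R) : 0 <= a -> a <= c -> c <= 1 -> 0 < mu ->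
  (forall s, a <= s <= c -> mu <= `|u k s|) ->
  (forall s, a <= s <= c -> 0 <= u k.+1 s) \/
    (forall s, a <= s <= c -> u k.+1 s <= 0) ->
  `|Phi c - Phi a| <= vdc_const b k * A * mu `^ (- k.+1%:R^-1).
Proof.
have b0 : 0 <= b by rewrite (le_trans _ (betab 0)).
have A0 : 0 <= A by rewrite (le_trans _ (psiA (s := 0) _))// lexx ler01.
elim: k a c mu => [|k IH] a c mu a0 ac c1 mu0 umu us.
  have sub s : a <= s <= c -> 0 <= s <= 1.
    by move=> /andP[ps sq]; rewrite (le_trans a0)// (le_trans sq).
  rewrite invr1 powRN powRr1 ?(ltW mu0)//= [_ * A]mulrC.
  apply: (@vdc_first R P (u 0%N) (u 1%N) psi dpsi Phi (beta 0%N) A b mu a c) => //.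
  - by lra.
  - by move=> s /sub; exact: dpsiE.
  - by move=> s /sub; exact: dPhi.
  - by move=> s /sub; exact: psiA.
  - by move=> s /sub; exact: dpsiA.
have sub s : a <= s <= c -> 0 <= s <= 1.
  by move=> /andP[ps sq]; rewrite (le_trans a0)// (le_trans sq).
(* Being bounded away from 0, [u k.+1] keeps its sign. With the integrating factor in [w], whose
   derivative is a positive multiple of [u k.+1], this makes [w] monotone; it also supplies the sign
   hypothesis of the induction. *)
have sgn := @constant_sign (u k.+1) _ a c mu ac mu0 (fun s _ => du k.+1 s) umu.
pose w (s : R) := expR (- beta k * s) * u k s.
pose dw (s : R) := expR (- beta k * s) * u k.+1 s.
have dwE (s : R) : is_derive s 1 w (dw s).
  have := is_derive1M
    (is_derive1_expR (is_derive1Z (- beta k) (is_derive_id s 1))) (du k s).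
  by move=> h; apply: is_derive_eq h _; rewrite /dw; ring.
have ebound x s : 0 <= s <= 1 -> `|x| <= b -> expR (- b) <= expR (x * s).
  move=> /andP[s0 s1]; rewrite ler_norml => /andP[xb _]; rewrite ler_expR.
  rewrite -subr_ge0; have -> : x * s - - b = (x + b) * s + b * (1 - s) by ring.
  by rewrite addr_ge0// mulr_ge0//; lra.
pose m := expR (- b) * mu.
have m0 : 0 < m by rewrite mulr_gt0// expR_gt0.
have [z zac wz] : exists2 z, a <= z <= c &
    forall s, a <= s <= c -> m * `|s - z| <= `|w s|.
  case: sgn => sgn.
    apply: (@monotone_zero R w dw a c m ac (ltW m0)) => s sac.
    rewrite /m /dw ler_pM ?expR_ge0 ?(ltW mu0) ?sgn//.
    by rewrite ebound ?normrN ?sub.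
  have [s sac|z zac wz] := @monotone_zero R (fun s => (-1) * w s)
      (fun s => (-1) * dw s) a c m ac (ltW m0).
    rewrite /m /dw mulN1r -mulrN ler_pM ?expR_ge0 ?(ltW mu0)//.
      by rewrite ebound ?normrN ?sub.
    by have := sgn _ sac; lra.
  by exists z => // s /wz; rewrite mulN1r normrN.
have ukw s : a <= s <= c -> expR (- (2 * b)) * (mu * `|s - z|) <= `|u k s|.
  move=> sac; have -> : u k s = expR (beta k * s) * w s.
    by rewrite /w mulrA -expRD mulNr subrr expR0 mul1r.
  rewrite normrM (ger0_norm (expR_ge0 _)).
  have -> : - (2 * b) = - b - b by ring.
  rewrite expRD -mulrA ler_pM ?expR_ge0 ?mulr_ge0 ?expR_ge0 ?(ltW mu0)//.
    by rewrite ebound ?sub.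
  by rewrite mulrA wz.
pose d := mu `^ (- k.+2%:R^-1).
have d0 : 0 < d by exact: powR_gt0.
pose nu := expR (- (2 * b)) * (mu * d).
have nu0 : 0 < nu by rewrite !mulr_gt0// expR_gt0.
have IH' p q : a <= p -> p <= q -> q <= c ->
    (forall s, p <= s <= q -> d <= `|s - z|) ->
    `|Phi q - Phi p| <= vdc_const b k * A * expR (2 * b) * d.
  move=> ap pq qc sd.
  have sub' s : p <= s <= q -> a <= s <= c.
    by move=> /andP[ps sq]; rewrite (le_trans ap)// (le_trans sq).
  apply: (le_trans (IH p q nu _ pq _ nu0 _ _)).
  - exact: le_trans ap.
  - exact: le_trans c1.
  - move=> s spq; rewrite (le_trans _ (ukw _ (sub' _ spq)))// /nu.
    by rewrite !ler_wpM2l ?expR_ge0 ?(ltW mu0)// sd.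
  - case: sgn => H; [left|right] => s /sub' /H; lra.
  - rewrite -[X in _ <= X]mulrA ler_wpM2l ?mulr_ge0 ?vdc_const_ge0//.
    exact: vdc_window_exponent.
have zac' := zac; move/andP: zac' => [az zc].
(* The window is clipped to [a, c], so either side piece may degenerate to a point. *)
pose p := Num.max a (z - d).
pose q := Num.min c (z + d).
have ap : a <= p by rewrite le_max lexx.
have qc : q <= c by rewrite ge_min lexx.
have pz : p <= z by rewrite ge_max az; lra.
have zq : z <= q by rewrite le_min zc; lra.
have pq := le_trans pz zq.
have dp : z - d <= p by rewrite le_max lexx orbT.
have qd : q <= z + d by rewrite ge_min lexx orbT.
set Q := vdc_const b k * A * expR (2 * b) * d in IH'.
have Q0 : 0 <= Q by rewrite !mulr_ge0 ?vdc_const_ge0 ?expR_ge0 ?(ltW d0).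
have L1 : `|Phi p - Phi a| <= Q.
  have [E|pa] := eqVneq p a; first by rewrite E subrr normr0.
  apply: IH' => //; first exact: le_trans qc.
  move=> s /andP[_ sp].
  have pE : p = z - d.
    move: pa; rewrite /p /Num.max /Order.max; case: ifP => //; by rewrite eqxx.
  rewrite distrC ger0_norm; lra.
have L3 : `|Phi c - Phi q| <= Q.
  have [E|pa] := eqVneq q c; first by rewrite E subrr normr0.
  apply: IH' => //; first exact: le_trans pq.
  move=> s /andP[sp _].
  have pE : q = z + d.
    move: pa; rewrite /q /Num.min /Order.min; case: ifP => //; by rewrite eqxx.
  rewrite ger0_norm; lra.
have L2 : `|Phi q - Phi p| <= A * (2 * d).
  apply: (le_trans (vdc_trivial (le_trans a0 ap) pq (le_trans qc c1))).
  by rewrite ler_wpM2l//; lra.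
have -> : Phi c - Phi a = (Phi p - Phi a) + (Phi q - Phi p) + (Phi c - Phi q) by ring.
apply: (le_trans (ler_normD _ _)); apply: (le_trans (lerD (ler_normD _ _) (lexx _))).
have -> : vdc_const b k.+1 * A * mu `^ (- k.+2%:R^-1) = A * (2 * d) + 2 * Q.
  by rewrite /= -/d /Q; ring.
by lra.
Qed.

End van_der_corput_chain.

Section exponential_sums.
Variable R : realType.

Lemma is_derive1_sum (I : finType) (f : I -> R -> R) (df : I -> R) (x : R) :
  (forall k, is_derive x 1 (f k) (df k)) ->
  is_derive x 1 (fun s => \sum_k f k s) (\sum_k df k).
Proof.
move=> h; rewrite -!big_enum /=.
rewrite (_ : (fun s => \sum_k f k s) = (fun s => \sum_(k <- enum I) f k s)); last first.
  by apply/funext => s; rewrite big_enum.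
elim: (enum I) => [|k s IH].
  rewrite big_nil (_ : (fun _ => _) = cst 0); first exact: is_derive_cst.
  by apply/funext => t; rewrite big_nil.
rewrite big_cons (_ : (fun _ => _) = (fun t => f k t + \sum_(j <- s) f j t)).
  exact: is_derive1D.
by apply/funext => t; rewrite big_cons.
Qed.

(** [K] is chosen before the coefficients, which will depend on x and lambda. The roots in [bs]
    annihilate every term except that of index [i]; [bi != 0] and [bi \notin bs] keep that one from
    vanishing. *)
Lemma exp_sum_oscillation (bi : R) (bs : seq R) : bi != 0 -> bi \notin bs ->
  exists2 K : R, 0 < K &
  forall (I : finType) (e c : I -> R) (i : I) (c0 : R)
    (psi dpsi Phi : R -> R) (A : R),
  e i = bi -> c i != 0 ->
  (forall k, k != i -> c k = 0 \/ e k \in bs) ->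
  (forall s : R, 0 <= s <= 1 -> is_derive s 1 psi (dpsi s)) ->
  (forall s : R, 0 <= s <= 1 ->
     is_derive s 1 Phi (cos (\sum_k c k * expR (e k * s) + c0) * psi s)) ->
  (forall s : R, 0 <= s <= 1 -> `|psi s| <= A) ->
  (forall s : R, 0 <= s <= 1 -> `|dpsi s| <= A) ->
  `|Phi 1 - Phi 0| <= K * A * `|c i| `^ (- (size bs).+1%:R^-1).
Proof.
move=> bi0 bibs; pose m := size bs.
(* The default value [bi] is the root used at index [m]: it annihilates the surviving term, so that
   [u m.+1] vanishes and meets the sign hypothesis of [vdc_chain]. *)
pose beta j := nth bi bs j.
pose b := `|bi| + \sum_(x <- bs) `|x|.
have bib : `|bi| <= b by rewrite lerDl sumr_ge0.
have b0 : 0 <= b by rewrite (le_trans _ bib).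
have betab j : `|beta j| <= b.
  have [jm|jm] := ltnP j (size bs); last by rewrite /beta nth_default.
  rewrite (le_trans _ (_ : \sum_(x <- bs) `|x| <= b)) ?lerDr//.
  by rewrite (big_rem _ (mem_nth bi jm))/= lerDl sumr_ge0.
(* On [0, 1] one has |u m| >= |c i| * kap, the factor [expR (- b)] bounding e^(bi s) from below. *)
pose kap := `|bi * \prod_(l < m) (bi - beta l)| * expR (- b).
have kap0 : 0 < kap.
  rewrite mulr_gt0 ?expR_gt0// normr_gt0 mulf_neq0//.
  rewrite prodf_seq_neq0; apply/allP => l _ /=.
  rewrite subr_eq0; apply: contraNneq bibs => ->.
  exact: mem_nth.
exists ((vdc_const b m + 1) * kap `^ (- m.+1%:R^-1)).
  by rewrite mulr_gt0 ?powR_gt0// ltr_pwDr// vdc_const_ge0.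
move=> I e c i c0 psi dpsi Phi A ei ci ce dpsiE dPhi psiA dpsiA.
pose P s := \sum_k c k * expR (e k * s) + c0.
(* Each factor [e k - beta l] kills one exponent; only [bi] survives in [u m]. *)
pose u j s := \sum_k c k * e k * \prod_(l < j) (e k - beta l) * expR (e k * s).
have dP (s : R) : is_derive s 1 P (u 0%N s).
  have h : is_derive s 1 (fun s => \sum_k c k * expR (e k * s))
      (\sum_k c k * (expR (e k * s) * (e k * 1))).
    exact: (is_derive1_sum (fun k => is_derive1Z _
      (is_derive1_expR (is_derive1Z (e k) (is_derive_id s 1))))).
  have := is_derive1D h (is_derive_cst c0 s 1) => h2; apply: is_derive_eq h2 _.
  by rewrite addr0; apply: eq_bigr => k _; rewrite big_ord0; ring.
have du j (s : R) : is_derive s 1 (u j) (beta j * u j s + u j.+1 s).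
  have h : is_derive s 1 (u j) (\sum_k c k * e k * \prod_(l < j) (e k - beta l) *
      (expR (e k * s) * (e k * 1))).
    exact: (is_derive1_sum (fun k => is_derive1Z _
      (is_derive1_expR (is_derive1Z (e k) (is_derive_id s 1))))).
  apply: is_derive_eq h _; rewrite /u big_distrr -big_split /=.
  by apply: eq_bigr => k _; rewrite big_ord_recr /=; ring.
have umE s : u m s = c i * (bi * \prod_(l < m) (bi - beta l)) * expR (bi * s).
  rewrite /u (bigD1 i)//= [X in _ + X]big1; first by rewrite ei addr0 mulrA.
  move=> k /ce[->|kbs]; first by rewrite !mul0r.
  rewrite (_ : \prod_(l < m) _ = 0) ?mulr0 ?mul0r//.
  have km : (index (e k) bs < m)%N by rewrite index_mem.
  by rewrite (bigD1 (Ordinal km))//= /beta nth_index// subrr mul0r.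
have um1E s : u m.+1 s = 0.
  rewrite /u big1// => k _; rewrite big_ord_recr /=.
  have [->|/ce[->|kbs]] := eqVneq k i.
  - by rewrite /beta nth_default// ei subrr !(mulr0, mul0r).
  - by rewrite !mul0r.
  rewrite (_ : \prod_(l < m) _ = 0) ?mulr0 ?mul0r ?mulr0 ?mul0r//.
  have km : (index (e k) bs < m)%N by rewrite index_mem.
  by rewrite (bigD1 (Ordinal km))//= /beta nth_index// subrr mul0r.
have A0 : 0 <= A by rewrite (le_trans _ (psiA 0 _))// lexx ler01.
have cim : 0 < `|c i| * kap by rewrite mulr_gt0// normr_gt0.
have := @vdc_chain R P u beta b betab dP du psi dpsi Phi A dpsiE dPhi psiA dpsiA
  m 0 1 (`|c i| * kap) (lexx _) ler01 (lexx _) cim.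
move=> H; apply: le_trans (H _ _) _.
- move=> s /andP[s0 s1]; rewrite umE 2!normrM /kap -mulrA ler_wpM2l//.
  rewrite ler_wpM2l// ger0_norm ?expR_ge0// ler_expR.
  rewrite -subr_ge0; have -> : bi * s - - b = (bi + b) * s + b * (1 - s) by ring.
  move: bib; rewrite ler_norml => /andP[bib _].
  by rewrite addr_ge0// mulr_ge0//; lra.
- by left => s _; rewrite um1E.
rewrite [`|c i| * kap]mulrC powRM ?(ltW kap0)// mulrA ler_wpM2r ?powR_ge0//.
rewrite [X in _ <= X]mulrAC ler_wpM2r ?powR_ge0// ler_wpM2r//; lra.
Qed.

End exponential_sums.

Lemma antiderivative (R : realType) (G : R -> R) : continuous G ->
  exists Phi : R -> R, forall s : R, 0 <= s <= 1 -> is_derive s 1 Phi (G s).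
Proof.
move=> cG.
(* The integral starts at -1 and integrability is used up to 2, so that 0 and 1 are interior points
   and the derivatives there are two-sided. *)
pose Phi (x : R) : R := (\int[lebesgue_measure]_(t in [set` `[-1, x]%R]) G t)%R.
exists Phi => s /andP[s0 s1].
have iG : lebesgue_measure.-integrable `[(-1) : R, 2] (EFin \o G).
  apply: continuous_compact_integrable; first exact: segment_compact.
  exact: continuous_subspaceT.
have s2 : s < 2 by lra.
have s1' : -1 < s by lra.
have [dPhi PhiE] := continuous_FTC1_closed s2 iG s1' (cG s).
have := @DeriveDef _ _ _ s 1 Phi (G s) dPhi; apply.
by rewrite -derive1E; exact: PhiE.
Qed.

(** On each of the N + 1 intervals the increment of [Phi] is a value of [G] times the length, and
    this value differs from the one at the left endpoint by at most [L] times the length. The total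
    error is at most L / (N + 1). *)
Lemma riemann_sum_cvg (R : realType) (G dG Phi : R -> R) (L : R) :
  (forall s : R, 0 <= s <= 1 -> is_derive s 1 G (dG s)) ->
  (forall s : R, 0 <= s <= 1 -> is_derive s 1 Phi (G s)) ->
  (forall s : R, 0 <= s <= 1 -> `|dG s| <= L) ->
  (fun N => N.+1%:R^-1 * \sum_(k < N.+1) G (k%:R / N.+1%:R)) @ \oo -->
  Phi 1 - Phi 0.
Proof.
move=> dGE dPhi dGL.
have L0 : 0 <= L by rewrite (le_trans _ (dGL 0 _))// lexx ler01.
suff H N : `|Phi 1 - Phi 0 - N.+1%:R^-1 * \sum_(k < N.+1) G (k%:R / N.+1%:R)| <=
    L * N.+1%:R^-1.
  apply/cvgrPdist_le => e e0.
  have : (fun N => L * N.+1%:R^-1) @ \oo --> L * 0.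
    by apply: cvgMr; exact: cvg_harmonic.
  rewrite mulr0 => /cvgrPdist_le/(_ e e0) [N0 _ HN]; exists N0 => // N N0N.
  rewrite /= (le_trans (H N))//; have := HN N N0N; rewrite /= sub0r normrN.
  by apply: le_trans; rewrite ler_norm.
pose M : R := N.+1%:R; rewrite -/M.
have M0 : 0 < M by rewrite ltr0n.
pose x (k : nat) : R := k%:R / M.
have x0 : x 0%N = 0 by rewrite /x mul0r.
have xN : x N.+1 = 1 by rewrite /x divff// gt_eqF.
have -> : Phi 1 - Phi 0 = \sum_(k < N.+1) (Phi (x k.+1) - Phi (x k)).
  rewrite -(big_mkord xpredT (fun k => Phi (x k.+1) - Phi (x k))).
  by rewrite (telescope_sumr (fun k => Phi (x k)))// x0 xN.
rewrite mulr_sumr -sumrB.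
apply: (le_trans (ler_norm_sum _ _ _)).
have -> : L / M = \sum_(k < N.+1) (L / M ^+ 2).
  rewrite sumr_const card_ord -[RHS]mulr_natr -/M expr2.
  by field; rewrite gt_eqF.
apply: ler_sum => k _; rewrite -/(x k).
have xS : x k.+1 = x k + M^-1 by rewrite /x -natr1 mulrDl mul1r.
have xk0 : 0 <= x k by rewrite divr_ge0// ltW.
have xk1 : x k.+1 <= 1 by rewrite ler_pdivrMr// mul1r ler_nat.
have xkS : x k <= x k.+1 by rewrite xS lerDl invr_ge0 ltW.
have [|t /andP[t0 t1] E] := @MVT_real R Phi G (x k) (x k.+1) xkS.
  by move=> s /andP[s0 s1]; apply: dPhi; rewrite (le_trans xk0)// (le_trans s1).
have [|r /andP[r0 r1] E2] := @MVT_real R G dG (x k) t t0.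
  move=> s /andP[s0 s1]; apply: dGE.
  by rewrite (le_trans xk0)//= (le_trans s1)// (le_trans t1).
rewrite E xS (addrAC (x k)) subrr add0r mulrC -mulrBr E2 !normrM.
rewrite (ger0_norm (_ : 0 <= M^-1)) ?invr_ge0 ?(ltW M0)//.
have -> : L / M ^+ 2 = M^-1 * (L * M^-1) by field; rewrite gt_eqF.
rewrite ler_wpM2l ?invr_ge0 ?(ltW M0)// ler_pM// ?dGL//.
  by rewrite (le_trans xk0)//= (le_trans r1)// (le_trans t1).
by rewrite ger0_norm ?subr_ge0// lerBlDr addrC -xS.
Qed.

(** * Averaging over dilation orbits *)

Section orbit.
Variables (R : realType) (n : nat) (a : 'I_n -> R).
Hypothesis a0 : forall j, 0 < a j.

(** The homogeneous dimension: [dil a (expR s)] has Jacobian [expR (hdim * s)]. *)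
Definition hdim : R := \sum_j (a j)^-1.

Lemma hdim_ge0 : 0 <= hdim.
Proof. by apply: sumr_ge0 => j _; rewrite invr_ge0 ltW. Qed.

Lemma tnth_dil t (x : Rn R n) j : tnth (dil a t x) j = t `^ (a j)^-1 * tnth x j.
Proof. by rewrite tnth_mktuple. Qed.

Lemma dil_dil t s (x : Rn R n) : 0 < t -> 0 < s ->
  dil a t (dil a s x) = dil a (t * s) x.
Proof.
move=> t0 s0; apply: eq_from_tnth => j; rewrite !tnth_dil.
by rewrite mulrA powRM ?(ltW t0) ?(ltW s0).
Qed.

Lemma dil1 (x : Rn R n) : dil a 1 x = x.
Proof. by apply: eq_from_tnth => j; rewrite tnth_dil powR1 mul1r. Qed.

Lemma tnth_dil_expR s (x : Rn R n) j :
  tnth (dil a (expR s) x) j = expR ((a j)^-1 * s) * tnth x j.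
Proof. by rewrite tnth_dil powR_expR ?expR_gt0// expRK. Qed.

Lemma dil_neq0 t (x : Rn R n) : 0 < t -> x <> @origin R n -> dil a t x <> @origin R n.
Proof.
move=> t0 x0 H; apply: x0; rewrite -[x]dil1 -(mulVf (lt0r_neq0 t0)).
rewrite -dil_dil ?invr_gt0// H; apply: eq_from_tnth => j.
by rewrite tnth_dil !tnth_mktuple mulr0.
Qed.

Lemma Rintegral_dil s (h : Rn R n -> R) :
  (@leb R n).-integrable setT (EFin \o h) ->
  (@leb R n).-integrable setT
    (EFin \o (fun x => expR (hdim * s) * h (dil a (expR s) x))) /\
  Rintegral (@leb R n) setT h =
  Rintegral (@leb R n) setT (fun x => expR (hdim * s) * h (dil a (expR s) x)).
Proof.
move=> ih; pose r j := expR s `^ (a j)^-1.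
have r0 j : 0 < r j by rewrite powR_gt0 ?expR_gt0.
have rE : \prod_j r j = expR (hdim * s).
  rewrite /hdim mulr_suml expR_sum; apply: eq_bigr => j _.
  by rewrite /r powR_expR ?expR_gt0// expRK.
have ihS := integrable_tscale r0 ih.
split; last first.
  rewrite (Rintegral_tscale r0 ih) rE -RintegralZl//.
exact: (integrableZl _ _ ihS).
Qed.

(** The real-valued form of [admissible], satisfied by the real and the imaginary part, since the
    van der Corput estimate is applied to real amplitudes. *)
Record orbit_admissible (g p : Rn R n -> R) : Prop := OrbitAdmissible {
  oadm_int : (@leb R n).-integrable setT (EFin \o p);
  oadm_supp : forall x : Rn R n, 1 < \sum_j tnth x j ^+ 2 -> p x = 0;
  oadm_C1 : forall x : Rn R n, x <> @origin R n -> C1_pos (fun t => p (dil a t x));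
  oadm_le : forall x : Rn R n, x <> @origin R n -> `|p x| <= g x;
  oadm_dle : forall x : Rn R n, x <> @origin R n ->
    `|derive1 (fun t : R => p (dil a t x)) 1| <= g x }.

Lemma cabs_Re (z : R[i]) : `|complex.Re z| <= cabs z.
Proof.
by case: z => x y; rewrite /cabs /= -sqrtr_sqr ler_wsqrtr// lerDl sqr_ge0.
Qed.

Lemma cabs_Im (z : R[i]) : `|complex.Im z| <= cabs z.
Proof.
by case: z => x y; rewrite /cabs /= -sqrtr_sqr ler_wsqrtr// lerDr sqr_ge0.
Qed.

Lemma admissible_Re g phi : admissible a g phi ->
  orbit_admissible g (fun x => complex.Re (phi x)).
Proof.
move=> [[iR iI] supp C1 le]; split => //.
- by move=> x /supp ->.
- by move=> x /C1[].
- by move=> x /le[le1 _]; exact: le_trans (cabs_Re _) le1.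
- move=> x /le[_ le2]; exact: le_trans (cabs_Re _) le2.
Qed.

Lemma admissible_Im g phi : admissible a g phi ->
  orbit_admissible g (fun x => complex.Im (phi x)).
Proof.
move=> [[iR iI] supp C1 le]; split => //.
- by move=> x /supp ->.
- by move=> x /C1[].
- by move=> x /le[le1 _]; exact: le_trans (cabs_Im _) le1.
- move=> x /le[_ le2]; exact: le_trans (cabs_Im _) le2.
Qed.

Variables (rho : R) (g p : Rn R n -> R).
Hypotheses (hg : mixed_homogeneous_off0 a rho g) (ap : orbit_admissible g p).

(** The Jacobian factor makes the integral over x of the dilated integrand independent of s. *)
Definition orbit_amp (x : Rn R n) (s : R) : R :=
  expR (hdim * s) * p (dil a (expR s) x).

(** The derivative along an orbit is controlled only at t = 1. Since dilations compose, the
    derivative at e^s on the orbit of x is read off at t = 1 on the orbit of the dilated point, and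
    homogeneity turns the value of [g] there into e^(rho s) g(x). *)
Lemma orbit_amp_derive (x : Rn R n) : x <> @origin R n ->
  exists dpsi : R -> R, forall s : R, is_derive s 1 (orbit_amp x) (dpsi s) /\
    `|dpsi s| <= (hdim + 1) * expR ((hdim + rho) * s) * g x.
Proof.
move=> x0; pose q t := p (dil a t x).
pose dq s := expR s * derive1 q (expR s).
have qd (s : R) : is_derive s 1 (fun s => q (expR s)) (dq s).
  have [dq1 _] := oadm_C1 ap x0 (expR_gt0 s).
  have h : is_derive (expR s) 1 q (derive1 q (expR s)).
    by rewrite derive1E; exact: derivableP.
  have := @is_derive1_comp R q expR s _ _ h (is_derive_expR s).
  by move=> h2; apply: is_derive_eq h2 _; rewrite /dq /GRing.scale/= mulrC.
have gE s : g (dil a (expR s) x) = expR (rho * s) * g x.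
  by rewrite hg ?expR_gt0// powR_expR ?expR_gt0// expRK.
exists (fun s => expR (hdim * s) * (hdim * 1) * q (expR s) + expR (hdim * s) * dq s).
move=> s; split.
  have h := is_derive1M (is_derive1_expR (is_derive1Z hdim (is_derive_id s 1))) (qd s).
  exact: h.
have y0 : dil a (expR s) x <> @origin R n by exact: dil_neq0 (expR_gt0 s) x0.
have dqle : `|dq s| <= expR (rho * s) * g x.
  rewrite -gE (le_trans _ (oadm_dle ap y0))// le_eqVlt; apply/orP; left.
  apply/eqP; congr `|_|; apply/esym; rewrite derive1E; apply: derive_val.
  have h : is_derive (1:R) 1 (fun t => q (t * expR s)) (dq s).
    have [dq1 _] := oadm_C1 ap x0 (expR_gt0 s).
    have h1 : is_derive (1 * expR s) 1 q (derive1 q (expR s)).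
      by rewrite mul1r derive1E; exact: derivableP.
    have h2 : is_derive (1:R) 1 (fun t : R => t * expR s) (expR s).
      have := is_derive1M (is_derive_id (1:R) 1) (is_derive_cst (expR s) (1:R) 1).
      by move=> h2; apply: is_derive_eq h2 _; rewrite /cst; ring.
    have := @is_derive1_comp R q (fun t : R => t * expR s) 1 _ _ h1 h2.
    by move=> h3; apply: is_derive_eq h3 _; rewrite /dq /GRing.scale/= mulrC.
  apply: near_eq_is_derive h; near=> t.
  by rewrite /q dil_dil ?expR_gt0//; near: t; exact: lt_nbhsr.
have ple : `|q (expR s)| <= expR (rho * s) * g x.
  by rewrite -gE /q; exact: (oadm_le ap y0).
apply: (le_trans (ler_normD _ _)); rewrite !normrM normr1 mulr1.
rewrite (ger0_norm (expR_ge0 _)) (ger0_norm hdim_ge0).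
have -> : (hdim + 1) * expR ((hdim + rho) * s) * g x =
   expR (hdim * s) * hdim * (expR (rho * s) * g x) +
   expR (hdim * s) * (expR (rho * s) * g x).
  by rewrite (mulrDl hdim rho) expRD; ring.
apply: lerD; rewrite ler_wpM2l// ?mulr_ge0 ?expR_ge0 ?hdim_ge0//. by rewrite -normrM.
Unshelve. all: by end_near. Qed.

Lemma orbit_amp_le (x : Rn R n) s : x <> @origin R n ->
  `|orbit_amp x s| <= expR ((hdim + rho) * s) * g x.
Proof.
move=> x0; rewrite /orbit_amp normrM (ger0_norm (expR_ge0 _)) mulrDl expRD -mulrA.
rewrite ler_wpM2l ?expR_ge0//.
have y0 : dil a (expR s) x <> @origin R n by exact: dil_neq0 (expR_gt0 s) x0.
apply: (le_trans (oadm_le ap y0)).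
by rewrite hg ?expR_gt0// powR_expR ?expR_gt0// expRK.
Qed.

(** For s >= 0 a dilation enlarges every coordinate, so an orbit that starts outside the cube stays
    outside the unit ball. *)
Lemma orbit_amp_cube (x : Rn R n) s : 0 <= s -> ~ cube x -> orbit_amp x s = 0.
Proof.
move=> s0 xc; rewrite /orbit_amp (oadm_supp ap) ?mulr0//.
have [j xj] : exists j, 1 < `|tnth x j|.
  apply: contrapT => H; apply: xc => j; rewrite -ler_norml leNgt.
  by apply/negP => xj; apply: H; exists j.
rewrite (bigD1 j)//= ltr_wpDr ?sumr_ge0//; first by move=> k _; exact: sqr_ge0.
rewrite tnth_dil_expR -[ltRHS]real_normK ?num_real// exprn_egt1//.
rewrite normrM (ger0_norm (expR_ge0 _)).
rewrite (lt_le_trans xj)// ler_peMl// -expR0 ler_expR mulr_ge0//.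
by rewrite invr_ge0 ltW.
Qed.

End orbit.

(* The case distinction is needed because 0 `^ (- d) = 0. *)
Definition decay (R : realType) (d y : R) : R :=
  if y == 0 then 1 else Num.min 1 (`|y| `^ (- d)).

Lemma decay_ge0 (R : realType) (d y : R) : 0 <= decay d y.
Proof. by rewrite /decay; case: ifP => // _; rewrite le_min ler01 powR_ge0. Qed.

Lemma decay_le1 (R : realType) (d y : R) : decay d y <= 1.
Proof. by rewrite /decay; case: ifP => // _; rewrite ge_min lexx. Qed.

Section orbit_average.
Variables (R : realType) (n : nat) (a : 'I_n -> R).
Hypothesis a0 : forall j, 0 < a j.

Definition phase (f : Rn R n -> R) (lam0 : R) (lam : 'I_n -> R) (x : Rn R n) : R :=
  lam0 * f x + \sum_j lam j * tnth x j.

(** The shift [c0] will be 0, pi / 2 or - pi / 2, so that one estimate for cosines covers the sines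
    as well. *)
Definition orbit_fun (f p : Rn R n -> R) lam0 lam (c0 : R) (x : Rn R n) (s : R) : R :=
  cos (phase f lam0 lam (dil a (expR s) x) + c0) * orbit_amp a p x s.

Definition orbit_mean f p lam0 lam c0 (N : nat) (x : Rn R n) : R :=
  N.+1%:R^-1 * \sum_(k < N.+1) orbit_fun f p lam0 lam c0 x (k%:R / N.+1%:R).

Variables (rho : R) (i : 'I_n) (bs : seq R).
Hypothesis ibs : (a i)^-1 \notin bs.
Hypothesis jbs : forall j, j != i -> (a j)^-1 \in bs.

(** The limit of the means is the integral over 0 <= s <= 1, to which [exp_sum_oscillation] applies.
    The bound [C * g x], uniform in [N], provides the dominating function for passing to the limit
    under the integral in x. *)
Lemma orbit_mean_cvg : exists2 C : R, 0 < C &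
  forall (f g p : Rn R n -> R) lam0 lam c0,
  mixed_homogeneous a f -> mixed_homogeneous_off0 a rho g ->
  orbit_admissible a g p -> (lam0 = 0 \/ 1 \in bs) ->
  forall x : Rn R n, x <> @origin R n ->
  (forall N, `|orbit_mean f p lam0 lam c0 N x| <= C * g x) /\
  exists2 l : R, orbit_mean f p lam0 lam c0 ^~ x @ \oo --> l &
     `|l| <= C * (g x * decay (size bs).+1%:R^-1 (lam i * tnth x i)).
Proof.
have ai0 : (a i)^-1 != 0 by rewrite invr_neq0// gt_eqF.
have [K K0 KP] := @exp_sum_oscillation R (a i)^-1 bs ai0 ibs.
pose sg := hdim a.
have sg0 : 0 <= sg by exact: hdim_ge0.
(* In units of [g x], this bounds the amplitude and its s-derivative on [0, 1] for either sign of
   [rho]. *)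
pose CA := (sg + 1) * expR (sg + `|rho|).
have CA0 : 0 < CA by rewrite mulr_gt0 ?expR_gt0// ltr_wpDl.
exists (CA * (1 + K)); first by rewrite mulr_gt0// addr_gt0.
move=> f g p lam0 lam c0 hf hg ap lam0bs x x0.
have g0 : 0 <= g x by rewrite (le_trans _ (oadm_le ap x0)).
(* Index [ord0] carries the term of [f], with exponent 1 by homogeneity; index [lift ord0 j] carries
   lam_j x_j. *)
pose c (k : 'I_n.+1) := if unlift ord0 k is Some j then lam j * tnth x j else lam0 * f x.
pose e (k : 'I_n.+1) := if unlift ord0 k is Some j then (a j)^-1 else 1.
pose P (s : R) := \sum_k c k * expR (e k * s) + c0.
pose psi := orbit_amp a p x.
have [dpsi dpsiP] := orbit_amp_derive a0 hg ap x0.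
have phaseE s : phase f lam0 lam (dil a (expR s) x) + c0 = P s.
  rewrite /P big_ord_recl /c /e unlift_none mul1r; congr (_ + _ + _).
    by rewrite hf ?expR_gt0//; ring.
  by apply: eq_bigr => j _; rewrite liftK tnth_dil_expR; ring.
pose dP s := \sum_k c k * (expR (e k * s) * (e k * 1)).
have dPE (s : R) : is_derive s 1 P (dP s).
  have h : is_derive s 1 (fun s => \sum_k c k * expR (e k * s)) (dP s).
    exact: (is_derive1_sum (fun k => is_derive1Z _
      (is_derive1_expR (is_derive1Z (e k) (is_derive_id s 1))))).
  by have := is_derive1D h (is_derive_cst c0 s 1); rewrite addr0.
pose G s := cos (P s) * psi s.
pose dG s := - sin (P s) * dP s * psi s + cos (P s) * dpsi s.
have dGE (s : R) : is_derive s 1 G (dG s).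
  exact: is_derive1M (is_derive1_cos (dPE s)) (dpsiP s).1.
have orbitE s : orbit_fun f p lam0 lam c0 x s = G s.
  by rewrite /orbit_fun phaseE.
have ebd s : 0 <= s <= 1 -> expR ((sg + rho) * s) <= expR (sg + `|rho|).
  move=> /andP[s0 s1]; rewrite ler_expR.
  have r1 := ler_norm rho; have r0 := normr_ge0 rho.
  rewrite (@le_trans _ _ ((sg + `|rho|) * s))// ?ler_wpM2r ?lerD2l//.
  by rewrite ler_piMr// addr_ge0.
have psiA s : 0 <= s <= 1 -> `|psi s| <= CA * g x.
  move=> s01; apply: (le_trans (orbit_amp_le hg ap s x0)).
  rewrite ler_wpM2r// (le_trans (ebd _ s01))// /CA ler_peMl ?expR_ge0//.
  by rewrite lerDr.
have dpsiA s : 0 <= s <= 1 -> `|dpsi s| <= CA * g x.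
  move=> s01; apply: (le_trans (dpsiP s).2); rewrite ler_wpM2r//.
  by rewrite /CA ler_wpM2l ?addr_ge0// ebd.
have GA s : 0 <= s <= 1 -> `|G s| <= CA * g x.
  move=> s01; rewrite normrM -[leRHS]mul1r ler_pM// ?psiA//.
  by rewrite ler_norml cos_geN1 cos_le1.
have CAg : 0 <= CA * g x by rewrite mulr_ge0// ltW.
have kN01 N (k : 'I_N.+1) : 0 <= (k%:R / N.+1%:R : R) <= 1.
  rewrite divr_ge0//= ler_pdivrMr ?ltr0n// mul1r ler_nat ltnW//.
have meanA N : `|orbit_mean f p lam0 lam c0 N x| <= CA * g x.
  rewrite normrM ger0_norm// ler_pdivrMl ?ltr0n//.
  apply: (le_trans (ler_norm_sum _ _ _)).
  apply: (@le_trans _ _ (\sum_(k < N.+1) (CA * g x))).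
    by apply: ler_sum => k _; rewrite orbitE; exact: GA.
  by rewrite sumr_const card_ord mulr_natl.
have CAC : CA * g x <= CA * (1 + K) * g x.
  by rewrite ler_wpM2r// ler_peMr ?(ltW CA0)// lerDl ltW.
split; first by move=> N; exact: le_trans CAC.
have cG : continuous G.
  move=> s; apply: differentiable_continuous; apply/derivable1_diffP.
  by have := dGE s => -[].
have [Phi dPhi] := antiderivative cG.
(* This Lipschitz bound depends on x and lambda; it serves only the convergence of the Riemann sums
   and does not enter the final constant. *)
pose L := (\sum_k `|c k| * (expR `|e k| * `|e k|)) * (CA * g x) + CA * g x.
have dPL s : 0 <= s <= 1 -> `|dP s| <= \sum_k `|c k| * (expR `|e k| * `|e k|).
  move=> /andP[s0 s1]; apply: (le_trans (ler_norm_sum _ _ _)).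
  apply: ler_sum => k _; rewrite !normrM normr1 mulr1 ler_wpM2l//.
  rewrite ler_wpM2r// ger0_norm ?expR_ge0// ler_expR.
  apply: (le_trans (ler_norm _)); by rewrite normrM (ger0_norm s0) ler_piMr.
have dGL s : 0 <= s <= 1 -> `|dG s| <= L.
  move=> s01; apply: (le_trans (ler_normD _ _)); apply: lerD.
    rewrite normrM ler_pM// ?psiA//.
    rewrite normrM normrN -[leRHS]mul1r ler_pM ?dPL//.
    by rewrite ler_norml sin_geN1 sin_le1.
  rewrite normrM -[leRHS]mul1r ler_pM ?dpsiA//.
  by rewrite ler_norml cos_geN1 cos_le1.
have := riemann_sum_cvg (fun s _ => dGE s) dPhi dGL => cv.
exists (Phi 1 - Phi 0).
  rewrite (_ : (fun N => _) =
    (fun N => N.+1%:R^-1 * \sum_(k < N.+1) G (k%:R / N.+1%:R)))//.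
  apply/funext => N; rewrite /orbit_mean; congr (_ * _).
  by apply: eq_bigr => k _; rewrite orbitE.
have l1 : `|Phi 1 - Phi 0| <= CA * g x.
  rewrite ler_norml; apply/andP; split.
    apply: (cvgr_to_ge cv); apply: nearW => N.
    have := meanA N; rewrite ler_norml => /andP[+ _]; rewrite /orbit_mean.
    by under eq_bigr do rewrite orbitE.
  apply: (cvgr_to_le cv); apply: nearW => N.
  have := meanA N; rewrite ler_norml => /andP[_]; rewrite /orbit_mean.
  by under eq_bigr do rewrite orbitE.
rewrite /decay; case: ifPn => [_|cx0].
  by rewrite mulr1; exact: le_trans CAC.
rewrite minr_pMr// mulr1 minr_pMr ?le_min; last by rewrite ltW// mulr_gt0// addr_gt0.
rewrite (le_trans l1 CAC)/=.
have := KP _ e c (lift ord0 i) c0 psi dpsi Phi (CA * g x).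
rewrite /e /c liftK => /(_ erefl cx0) KP'.
have {}KP' := KP' _ (fun s _ => (dpsiP s).1) dPhi psiA dpsiA.
apply: (le_trans (KP' _)).
  move=> k kl; case: unliftP => [j kE|_]; last first.
    by case: lam0bs => [->|]; [left; rewrite mul0r|right].
  right; apply: jbs; apply: contraNneq kl => ji.
  by rewrite kE ji.
have D0 := powR_ge0 `|lam i * tnth x i| (- (size bs).+1%:R^-1).
set D := _ `^ _ in D0 *; rewrite -subr_ge0.
have -> : CA * (1 + K) * (g x * D) - K * (CA * g x) * D = CA * g x * D by ring.
exact: mulr_ge0.
Qed.

End orbit_average.

Lemma measurable_decay (R : realType) (d : R) : measurable_fun setT (decay d).
Proof.
rewrite /decay; apply: measurable_fun_ifT; first by apply: measurable_fun_eqr.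
  exact: measurable_cst.
apply: measurable_minr; first exact: measurable_cst.
apply: (measurableT_comp (measurable_powR (- d))).
exact: normr_measurable.
Qed.

Section osc_integral_bound.
Variables (R : realType) (n : nat) (a : 'I_n -> R).
Hypothesis n1 : (1 <= n)%N.
Hypothesis a0 : forall j, 0 < a j.

Lemma measurable_phase (f : Rn R n -> R) lam0 lam :
  measurable_fun setT f -> measurable_fun setT (phase f lam0 lam).
Proof.
move=> mf; apply: measurable_funD.
  by apply: measurable_funM => //; exact: measurable_cst.
apply: measurable_sum => j; apply: measurable_funM; first exact: measurable_cst.
exact: measurable_tnth_Rn.
Qed.

Lemma integrable_osc (f p : Rn R n -> R) lam0 lam c0 :
  measurable_fun setT f -> (@leb R n).-integrable setT (EFin \o p) ->
  (@leb R n).-integrable setT (EFin \o (fun x => cos (phase f lam0 lam x + c0) * p x)).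
Proof.
move=> mf ip; apply: (le_integrable measurableT _ _ ip).
  apply/measurable_EFinP; apply: measurable_funM.
    apply: (measurableT_comp (continuous_measurable_fun (@continuous_cos R))).
    apply: measurable_funD; [exact: measurable_phase|exact: measurable_cst].
  by apply/measurable_EFinP; exact: measurable_int ip.
move=> x _ /=; rewrite lee_fin normrM -[leRHS]mul1r ler_wpM2r//.
by rewrite ler_norml cos_geN1 cos_le1.
Qed.

(** Every sample of the Riemann sum is a change of variables of the same integral, so the mean has
    exactly that integral for each [N]. *)
Lemma orbit_mean_integral (f p : Rn R n -> R) lam0 lam c0 N :
  measurable_fun setT f -> (@leb R n).-integrable setT (EFin \o p) ->
  (@leb R n).-integrable setT (EFin \o orbit_mean a f p lam0 lam c0 N) /\
  (\int[@leb R n]_x (orbit_mean a f p lam0 lam c0 N x)%:E =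
   (Rintegral (@leb R n) setT (fun x => cos (phase f lam0 lam x + c0) * p x))%:E)%E.
Proof.
move=> mf ip; have iF := integrable_osc lam0 lam c0 mf ip.
set J := Rintegral _ _ _.
have G s : (@leb R n).-integrable setT
     (EFin \o (fun x => orbit_fun a f p lam0 lam c0 x s)) /\
   (\int[@leb R n]_x (orbit_fun a f p lam0 lam c0 x s)%:E = J%:E)%E.
  have [i1 i2] := Rintegral_dil a s iF.
  have E : (fun x => orbit_fun a f p lam0 lam c0 x s) =
    (fun x => expR (hdim a * s) *
       (cos (phase f lam0 lam (dil a (expR s) x) + c0) * p (dil a (expR s) x))).
    by apply/funext => x; rewrite /orbit_fun /orbit_amp mulrCA.
  rewrite E; split; first exact: i1.
  rewrite /J i2 /Rintegral fineK; last exact: integrable_fin_num.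
  apply: eq_integral => x _.
  by rewrite -[X in X%:E]/((fun x => orbit_fun a f p lam0 lam c0 x s) x) E.
have iS : (@leb R n).-integrable setT (fun x =>
    \sum_(k < N.+1) (orbit_fun a f p lam0 lam c0 x (k%:R / N.+1%:R))%:E)%E.
  by apply: integrable_sum => // k _; exact: (G _).1.
have E : EFin \o orbit_mean a f p lam0 lam c0 N = (fun x =>
    (N.+1%:R^-1)%:E *
    \sum_(k < N.+1) (orbit_fun a f p lam0 lam c0 x (k%:R / N.+1%:R))%:E)%E.
  by apply/funext => x /=; rewrite /orbit_mean EFinM sumEFin.
split; first by rewrite E; exact: integrableZl.
rewrite -[X in integral _ _ X]/(EFin \o orbit_mean a f p lam0 lam c0 N) E.
rewrite integralZl// integral_sum//; last by move=> k; exact: (G _).1.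
rewrite (eq_bigr (fun=> J%:E)); last by move=> k _; exact: (G _).2.
by rewrite sumEFin sumr_const card_ord -EFinM -[J *+ _]mulr_natl mulrA mulVf ?mul1r.
Qed.

Variables (rho : R) (i : 'I_n) (bs : seq R).
Hypothesis ibs : (a i)^-1 \notin bs.
Hypothesis jbs : forall j, j != i -> (a j)^-1 \in bs.

Lemma osc_integral_decay : exists2 C : R, 0 < C &
  forall (f g p : Rn R n -> R) lam0 lam c0,
  measurable_fun setT f -> mixed_homogeneous a f ->
  (forall x, 0 <= g x) -> locally_integrable_Rn g ->
  mixed_homogeneous_off0 a rho g ->
  orbit_admissible a g p -> (lam0 = 0 \/ 1 \in bs) ->
  (`|Rintegral (@leb R n) setT (fun x => cos (phase f lam0 lam x + c0) * p x)|%:E <=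
   C%:E * \int[@leb R n]_(x in @cube R n)
     (g x * decay (size bs).+1%:R^-1 (lam i * tnth x i))%:E)%E.
Proof.
have [C C0 CP] := orbit_mean_cvg a0 rho ibs jbs.
exists C => // f g p lam0 lam c0 mf hf g0 lg hg ap lam0bs.
have {}CP := CP f g p lam0 lam c0 hf hg ap lam0bs.
have ip := oadm_int ap.
set J := Rintegral _ _ _.
set h := fun x : Rn R n => g x * decay (size bs).+1%:R^-1 (lam i * tnth x i).
have [j0 Hyp0] := leb_hyperplane R n1.
set Hyp := [set x | _] in Hyp0.
have mH : measurable Hyp.
  rewrite -[X in measurable X]setTI.
  by apply: (@measurable_tnth_Rn R n j0 measurableT [set 0]); exact: measurable_set1.
have mC := @measurable_cube R n.
(* The means vanish off the cube, and removing the null hyperplane removes the origin. *)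
pose D := @cube R n `\` Hyp.
have mD : measurable D by exact: measurableD.
have Dx0 x : D x -> x <> @origin R n.
  by move=> [_ xH] x0; apply: xH; rewrite x0 /Hyp /= tnth_mktuple.
pose M N := orbit_mean a f p lam0 lam c0 N.
have MI N := @orbit_mean_integral f p lam0 lam c0 N mf ip.
have MD N : (\int[@leb R n]_(x in D) (M N x)%:E = J%:E)%E.
  rewrite -(MI N).2 /D -negligible_integral//; last first.
    by apply: integrableS (MI N).1.
  rewrite integral_mkcond; apply: eq_integral => x _.
  rewrite /patch; case: ifPn => //; rewrite notin_setE => xc.
  rewrite /orbit_mean big1 ?mulr0// => k _.
  by rewrite /orbit_fun (orbit_amp_cube a0 ap _ xc) ?mulr0// divr_ge0.
pose l x := lim (M ^~ x @ \oo).
have lP x : D x -> M ^~ x @ \oo --> l x /\ `|l x| <= C * h x.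
  move=> /Dx0/CP[_ [l' cl' le']]; rewrite /l.
  by rewrite (cvg_lim _ cl').
have mM N : measurable_fun D (M N).
  apply: measurable_funTS; apply/measurable_EFinP.
  exact: measurable_int (MI N).1.
have ml : measurable_fun D l.
  by apply: (@measurable_fun_cvg _ _ _ D M l mM) => x /lP[].
have ig : (@leb R n).-integrable D (EFin \o (fun x => C * g x)).
  apply: (integrableZl mD C (f := EFin \o g)).
  apply: integrableS (mu_cube_integrable lg) => //.
  by move=> x [].
have cvJ : (fun N => \int[@leb R n]_(x in D) (M N x)%:E)%E @ \oo -->
    (\int[@leb R n]_(x in D) (l x)%:E)%E.
  have [] := @dominated_convergence _ _ _ (@leb R n) D mD
    (fun N => EFin \o M N) (EFin \o l) (EFin \o (fun x => C * g x)).
  - by move=> N; apply/measurable_EFinP; exact: mM.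
  - by apply/measurable_EFinP; exact: ml.
  - apply: aeW => x Dx; apply: cvg_EFin; first exact: nearW.
    exact: (lP x Dx).1.
  - exact: ig.
  - apply: aeW => x N Dx; rewrite /= lee_fin.
    exact: (CP x (Dx0 x Dx)).1.
  - by move=> _ _; apply.
(* The integrals of the means do not depend on [N], so their limit is [J] itself. *)
have JE : (J%:E = \int[@leb R n]_(x in D) (l x)%:E)%E.
  move: cvJ; under eq_fun do rewrite MD.
  by move/(cvg_lim (@ereal_hausdorff R)) => <-; rewrite lim_cst.
have mh : measurable_fun setT h.
  apply: measurable_funM; first exact: lg.1.
  apply: (measurableT_comp (@measurable_decay R _)).
  by apply: measurable_funM; [exact: measurable_cst|exact: measurable_tnth_Rn].
have h0 x : 0 <= h x by rewrite mulr_ge0// decay_ge0.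
rewrite -abse_EFin JE.
have mlE : measurable_fun D (EFin \o l) by apply/measurable_EFinP; exact: ml.
apply: (le_trans (le_abse_integral (@leb R n) mD mlE)).
pose k (x : Rn R n) := (C%:E * (h x)%:E)%E.
have mk A : measurable_fun A k.
  apply: measurable_funTS; apply/measurable_EFinP.
  by apply: measurable_funM; [exact: measurable_cst|exact: mh].
have k0 x : (0 <= k x)%E by rewrite /k -EFinM lee_fin mulr_ge0// ltW.
have mabs : measurable_fun D (fun x => `|(EFin \o l) x|%E).
  by apply/measurable_EFinP; apply: (measurableT_comp (@normr_measurable R setT) ml).
have -> : (C%:E * \int[@leb R n]_(x in @cube R n) (h x)%:E =
    \int[@leb R n]_(x in @cube R n) k x)%E.
  by apply/esym; exact: ge0_integralZl_real mC mh h0 (ltW C0).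
apply: (@le_trans _ _ (\int[@leb R n]_(x in D) k x)%E).
  apply: ge0_le_integral.
  - exact: mD.
  - by move=> x _; exact: abse_ge0.
  - exact: mabs.
  - exact: mk.
  - by move=> x /lP[_]; rewrite /k -EFinM lee_fin.
apply: ge0_subset_integral.
- exact: mD.
- exact: mC.
- exact: mk.
- by move=> x _; exact: k0.
- by move=> x [].
Qed.

End osc_integral_bound.

(** * Dyadic decomposition in the distinguished coordinate *)

Section dyadic.
Variable R : realType.

Definition log_factor (eps d L : R) : R := if eps == d then ln (2 + `|L|) else 1.

Lemma log_factor_ge (eps d L : R) : ln 2 <= log_factor eps d L.
Proof.
have l2 : ln 2 <= 1 :> R.
  by rewrite -[leRHS](expRK 1) ler_ln ?posrE ?expR_gt0// expR_ge1Dx.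
rewrite /log_factor; case: ifP => // _.
by rewrite ler_ln ?posrE ?lerDl// ltr_wpDr.
Qed.

Lemma ln2_gt0 : 0 < ln 2 :> R.
Proof. by rewrite ln_gt0// ltr1n. Qed.

Lemma geometric_sum_le (q : R) K : 1 < q -> \sum_(k < K) q ^+ k <= q ^+ K / (q - 1).
Proof.
move=> q1; rewrite ler_pdivlMr ?subr_gt0//.
have := subrX1 q K; rewrite mulrC => <-; lra.
Qed.

Lemma geometric_sum_le1 (q : R) K : 0 <= q -> q < 1 ->
  \sum_(k < K) q ^+ k <= (1 - q)^-1.
Proof.
move=> q0 q1; rewrite -[leRHS]mul1r ler_pdivlMr ?subr_gt0//.
have -> : (\sum_(k < K) q ^+ k) * (1 - q) = - ((q - 1) * \sum_(k < K) q ^+ k).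
  by ring.
by rewrite -subrX1; have := exprn_ge0 K q0; lra.
Qed.

(** For eps < d the geometric series converges; for eps > d its last term dominates, and 2^K <= l
    converts it into l^(eps - d); for eps = d all terms equal 1 and their number is of order ln
    l. *)
Lemma dyadic_sum_le (eps d : R) : 0 < eps -> 0 < d ->
  exists2 C : R, 0 < C & forall K (l : R), 1 <= l -> 2 ^+ K <= l ->
    l `^ (- eps) * \sum_(k < K.+2) (2 `^ (eps - d)) ^+ k <=
    C * (l `^ (- Num.min eps d) * log_factor eps d l).
Proof.
move=> e0 d0; have [ed|ed|ed] := ltgtP eps d.
- have q1 : 2 `^ (eps - d) < 1 :> R.
    by rewrite powR_expR// -[ltRHS]expR0 ltr_expR pmulr_llt0 ?ln2_gt0// subr_lt0.
  exists (1 - 2 `^ (eps - d))^-1; first by rewrite invr_gt0 subr_gt0.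
  move=> K l l1 _; rewrite /log_factor lt_eqF// mulr1 mulrC.
  by rewrite ler_wpM2r ?powR_ge0// geometric_sum_le1 ?powR_ge0.
- have q1 : 1 < 2 `^ (eps - d) :> R.
    by rewrite powR_expR// -[ltLHS]expR0 ltr_expR mulr_gt0 ?ln2_gt0// subr_gt0.
  set q := 2 `^ (eps - d) in q1 *.
  have q0 : 0 < q by exact: lt_trans q1.
  exists (q ^+ 2 / (q - 1)); first by rewrite divr_gt0 ?subr_gt0 ?exprn_gt0.
  move=> K l l1 Kl; rewrite /log_factor gt_eqF// mulr1.
  have l0 : 0 < l by exact: lt_le_trans l1.
  have qK : q ^+ K <= l `^ (eps - d).
    rewrite -powR_mulrn ?(ltW q0)// /q -powRrM mulrC powRrM powR_mulrn//.
    by rewrite ge0_ler_powR ?nnegrE ?subr_ge0 ?exprn_ge0 ?(ltW l0)// ltW.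
  apply: (@le_trans _ _ (l `^ (- eps) * (q ^+ K.+2 / (q - 1)))).
    by rewrite ler_wpM2l ?powR_ge0// geometric_sum_le.
  have -> : l `^ (- d) = l `^ (- eps) * l `^ (eps - d).
    by rewrite -powRD ?(gt_eqF l0) ?implybT//; congr (_ `^ _); ring.
  rewrite -addn2 exprD.
  have -> : q ^+ 2 / (q - 1) * (l `^ (- eps) * l `^ (eps - d)) =
    l `^ (- eps) * (l `^ (eps - d) * q ^+ 2 / (q - 1)) by ring.
  rewrite ler_wpM2l ?powR_ge0// ler_wpM2r ?invr_ge0 ?subr_ge0 ?(ltW q1)//.
  by rewrite ler_wpM2r// exprn_ge0// ltW.
(* For the K + 2 equal terms, K ln 2 <= ln (2 + l) and 2 ln 2 <= 2 ln (2 + l) add up to the 3. *)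
exists (3 / ln 2); first by rewrite divr_gt0 ?ln2_gt0.
move=> K l l1 Kl; rewrite /log_factor ed eqxx subrr powRr0.
have l0 : 0 < l by exact: lt_le_trans l1.
under eq_bigr do rewrite expr1n.
rewrite sumr_const card_ord mulrCA ler_wpM2l ?powR_ge0//.
rewrite mulrAC ler_pdivlMr ?ln2_gt0// (ger0_norm (ltW l0)).
have lnK : K%:R * ln 2 <= ln (2 + l).
  rewrite mulrC mulr_natr -lnXn// ler_ln ?posrE ?exprn_gt0 ?addr_gt0//.
  by rewrite (le_trans Kl)// lerDr.
have ln2 : ln 2 <= ln (2 + l) by rewrite ler_ln ?posrE ?addr_gt0// lerDl ltW.
have -> : (K.+2%:R : R) = K%:R + 2 by rewrite -addn2 natrD.
lra.
Qed.

Lemma dyadic_level (y : R) : 1 <= y -> exists K, 2 ^+ K <= y < 2 ^+ K.+1.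
Proof.
move=> y1; have y0 : 0 <= y by exact: le_trans y1.
pose m := Num.truncn y; exists (trunc_log 2 m).
have /andP[my ym] := truncn_itv y0.
have m0 : (0 < m)%N.
  by have := le_lt_trans y1 ym; rewrite -/m ltr1n ltnS.
have /andP[b1 b2] := trunc_log_bounds (isT : (1 < 2)%N) m0.
apply/andP; split.
  by rewrite (le_trans _ my)// -natrX ler_nat.
by rewrite (lt_le_trans ym)// -natrX ler_nat.
Qed.

(** If 2^(k-1) <= l |y| < 2^k, the decay is at most (2^(k-1))^(-d), the coefficient of level k;
    level 0 covers l |y| < 1. Since l |y| < 2^(K+1), levels 0 to K + 1 suffice. Full strips rather
    than shells are used because it is the mass of slabs that is bounded. *)
Lemma decay_le_dyadic (d l y : R) K : 0 < d -> 0 < l -> `|y| <= 1 -> l < 2 ^+ K.+1 ->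
  decay d (l * y) <=
  \sum_(k < K.+2) if `|y| < 2 ^+ k / l then 2 `^ (d - k%:R * d) else 0.
Proof.
move=> d0 l0 y1 lK.
have T k : 0 <= if `|y| < 2 ^+ k / l then 2 `^ (d - k%:R * d) else 0.
  by case: ifP => // _; rewrite powR_ge0.
have [ly|ly] := ltP (l * `|y|) 1.
  rewrite big_ord_recl ler_wpDr ?sumr_ge0//.
  rewrite (le_trans (decay_le1 _ _))// ltr_pdivlMr// expr0 mulrC ly.
  by rewrite mul0r subr0 -[leLHS](powRr0 2) ler_powR ?ler1n// ltW.
have [k /andP[ky yk]] := dyadic_level ly.
have kK : (k.+1 < K.+2)%N.
  rewrite ltnS -(@ltr_eXn2l _ (2 : R)) ?ltr1n//.
  by rewrite (le_lt_trans ky)// (le_lt_trans _ lK)// ler_piMr// ltW.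
rewrite (bigD1 (Ordinal kK))//= ler_wpDr ?sumr_ge0//.
rewrite ltr_pdivlMr// [`|y| * l]mulrC yk.
rewrite /decay; case: eqVneq => [ly0|ly0].
  by move: ly; rewrite -[l in l * _](ger0_norm (ltW l0)) -normrM ly0 normr0 ler10.
rewrite ge_min; apply/orP; right.
rewrite normrM (ger0_norm (ltW l0)).
have -> : d - k.+1%:R * d = - (k%:R * d) by rewrite -natr1; ring.
rewrite !powRN lef_pV2 ?posrE ?powR_gt0//; last exact: lt_le_trans ly.
rewrite powRrM powR_mulrn// ge0_ler_powR ?nnegrE ?exprn_ge0 ?(ltW d0)//.
exact: le_trans ly.
Qed.

End dyadic.

Lemma decay_norml (R : realType) (d L y : R) : decay d (L * y) = decay d (`|L| * y).
Proof. by rewrite /decay !mulf_eq0 normr_eq0 !normrM normr_id. Qed.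

Lemma powR_geometric (R : realType) (b d e : R) k : 0 < b ->
  b `^ (d - k%:R * d) * (b ^+ k) `^ e = b `^ d * (b `^ (e - d)) ^+ k.
Proof.
move=> b0; have bn : b != 0 by rewrite gt_eqF.
rewrite -(powR_mulrn k (ltW b0)) -(powR_mulrn k (powR_ge0 b (e - d))).
rewrite -!powRrM -!powRD ?bn ?implybT//.
by congr (_ `^ _); ring.
Qed.

Section slab_integral.
Variables (R : realType) (n : nat) (i : 'I_n).

Lemma slabE t : slab i t = @cube R n `&` [set x : Rn R n | `|tnth x i| < t].
Proof. by []. Qed.

Lemma measurable_strip t : measurable [set x : Rn R n | `|tnth x i| < t].
Proof.
rewrite -[X in measurable X]setTI.
have mt : measurable_fun setT (fun x : Rn R n => `|tnth x i|).
  by apply: (measurableT_comp (@normr_measurable R setT)); exact: measurable_tnth_Rn.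
rewrite (_ : [set x : Rn R n | _] = (fun x : Rn R n => `|tnth x i|) @^-1` `]-oo, t[).
  by apply: mt => //; exact: measurable_itv.
by apply/seteqP; split => x /=; rewrite in_itv.
Qed.

Lemma measurable_slab t : measurable (slab i t : set (Rn R n)).
Proof.
by rewrite slabE; apply: measurableI; [exact: measurable_cube|exact: measurable_strip].
Qed.

Variable g : Rn R n -> R.
Hypotheses (g0 : forall x, 0 <= g x) (lg : locally_integrable_Rn g).

Lemma measurable_density (A : set (Rn R n)) :
  measurable_fun A (fun x => (g x)%:E).
Proof. by apply/measurable_EFinP; apply: measurable_funTS; exact: lg.1. Qed.

Lemma mu_gE (A : set (Rn R n)) : (mu_g g A = \int[@leb R n]_(x in A) (g x)%:E)%E.
Proof. by apply: eq_integral => x _; rewrite ger0_norm. Qed.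

Lemma mu_g_ge0 (A : set (Rn R n)) : (0 <= mu_g g A)%E.
Proof. by apply: integral_ge0 => x _; rewrite lee_fin. Qed.

Lemma mu_g_subset (A B : set (Rn R n)) : measurable A -> measurable B ->
  A `<=` B -> (mu_g g A <= mu_g g B)%E.
Proof.
move=> mA mB AB; rewrite !mu_gE; apply: ge0_subset_integral.
- exact: mA.
- exact: mB.
- exact: measurable_density.
- by move=> x _; rewrite lee_fin.
- exact: AB.
Qed.

Lemma slab_cube t : slab i t `<=` @cube R n.
Proof. by move=> x []. Qed.

(** For |L| > 1 the slab of level k has mass at most D (2^k / |L|)^eps, which turns the integral
    into the sum of [dyadic_sum_le]. For |L| <= 1 the finite mass of the cube is enough, the
    logarithmic factor being at least ln 2. *)
Lemma decay_integral_le (eps d D : R) : 0 < eps -> 0 < d -> 0 < D ->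
  (forall t, 0 < t -> (mu_g g (slab i t) <= (D * t `^ eps)%:E)%E) ->
  exists2 E : R, 0 < E & forall L : R,
    (\int[@leb R n]_(x in @cube R n) (g x * decay d (L * tnth x i))%:E <=
     (E * ((1 + `|L|) `^ (- Num.min eps d) * log_factor eps d L))%:E)%E.
Proof.
move=> e0 d0 D0 Dle.
have [C C0 CP] := dyadic_sum_le e0 d0.
have mC := @measurable_cube R n.
set m := Num.min eps d in CP *.
have m0 : 0 < m by rewrite lt_min e0.
have Mfin : mu_g g (@cube R n) \is a fin_num.
  by rewrite ge0_fin_numE ?mu_g_ge0// mu_cube_lty.
set M := fine (mu_g g (@cube R n)).
have M0 : 0 <= M by rewrite fine_ge0// mu_g_ge0.
have l20 := @ln2_gt0 R.
have mgd L : measurable_fun (@cube R n) (fun x => (g x * decay d (L * tnth x i))%:E).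
  apply: measurable_funTS; apply/measurable_EFinP.
  apply: measurable_funM; first exact: lg.1.
  apply: (measurableT_comp (@measurable_decay R d)).
  by apply: measurable_funM; [exact: measurable_cst|exact: measurable_tnth_Rn].
(* For L >= 1 one has 1 + L <= 2 L, so passing from L to 1 + L costs a factor 2^m. *)
have pw L : 1 <= L -> L `^ (- m) <= 2 `^ m * (1 + L) `^ (- m).
  move=> L1; have L0 : 0 < L by exact: lt_le_trans L1.
  rewrite !powRN ler_pdivlMr ?powR_gt0 ?addr_gt0// mulrC ler_pdivrMr ?powR_gt0//.
  rewrite -powRM ?(ltW L0)// ge0_ler_powR ?nnegrE ?(ltW m0)//; lra.
exists (M * 2 `^ m / ln 2 + D * 2 `^ d * C * 2 `^ m).
  rewrite ltr_wpDl ?mulr_ge0 ?powR_ge0 ?invr_ge0 ?(ltW l20)//.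
  by rewrite !mulr_gt0 ?powR_gt0.
move=> L; set fac := log_factor eps d L.
have fac2 : ln 2 <= fac by exact: log_factor_ge.
have fac0 : 0 < fac by exact: lt_le_trans fac2.
have pw0 : 0 < (1 + `|L|) `^ (- m) by rewrite powR_gt0// ltr_pwDl.
have [L1|L1] := leP `|L| 1.
  apply: (@le_trans _ _ (mu_g g (@cube R n))).
    rewrite mu_gE; apply: ge0_le_integral.
    - exact: mC.
    - by move=> x _; rewrite lee_fin mulr_ge0// decay_ge0.
    - exact: mgd.
    - exact: measurable_density.
    - by move=> x _; rewrite lee_fin ler_piMr// decay_le1.
  rewrite -(fineK Mfin) lee_fin -/M mulrDl ler_wpDr//.
    by rewrite !mulr_ge0 ?powR_ge0// ltW.
  have H : 1 <= 2 `^ m * (1 + `|L|) `^ (- m).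
    rewrite powRN ler_pdivlMr ?powR_gt0 ?ltr_pwDl// mul1r.
    by rewrite ge0_ler_powR ?nnegrE ?addr_ge0 ?(ltW m0)//; lra.
  have H2 : 1 <= (ln 2)^-1 * fac by rewrite mulrC ler_pdivlMr// mul1r.
  rewrite (_ : _ * _ * _ = M * ((2 `^ m * (1 + `|L|) `^ (- m)) * ((ln 2)^-1 * fac))).
    by rewrite ler_peMr// mulr_ege1.
  by ring.
have L0 : 0 < `|L| by exact: lt_trans L1.
have [K /andP[KL LK]] := dyadic_level (ltW L1).
pose c k : R := 2 `^ (d - k%:R * d).
pose t k : R := 2 ^+ k / `|L|.
pose strip k := [set x : Rn R n | `|tnth x i| < t k].
have t0 k : 0 < t k by rewrite divr_gt0// exprn_gt0.
pose w k (x : Rn R n) := ((c k)%:E * ((fun x => (g x)%:E) \_ (strip k)) x)%E.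
have mw k : measurable_fun (@cube R n) (w k).
  apply: measurable_funeM.
  apply: measurable_funTS; apply/(measurable_restrictT _ _).1.
    exact: measurable_strip.
  exact: measurable_density.
have w0 k x : (0 <= w k x)%E.
  rewrite /w mule_ge0 ?lee_fin ?powR_ge0// /patch; case: ifP => // _.
  by rewrite lee_fin.
apply: (@le_trans _ _ (\int[@leb R n]_(x in @cube R n) (\sum_(k < K.+2) w k x))%E).
  apply: ge0_le_integral.
  - exact: mC.
  - by move=> x _; rewrite lee_fin mulr_ge0// decay_ge0.
  - exact: mgd.
  - by apply: emeasurable_sum => k; exact: mw.
  - move=> x xc; have xi : `|tnth x i| <= 1 by rewrite ler_norml; exact: xc.
    have H := decay_le_dyadic d0 L0 xi LK.
    have E : (\sum_(k < K.+2) w k x = (g x * \sum_(k < K.+2)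
        if `|tnth x i| < 2 ^+ k / `|L| then 2 `^ (d - k%:R * d) else 0)%:E)%E.
      rewrite mulr_sumr -sumEFin; apply: eq_bigr => k _; rewrite /w /patch.
      case: ifPn => [/set_mem|/negP] xs.
        by rewrite [X in if X then _ else _]xs -EFinM mulrC.
      case: ifPn => [xs'|_]; last by rewrite mulr0 mule0.
      by exfalso; apply: xs; exact: mem_set.
    by rewrite E lee_fin decay_norml ler_wpM2l.
rewrite ge0_integral_sum//.
have Ik k : (\int[@leb R n]_(x in @cube R n) w k x <= (c k * (D * t k `^ eps))%:E)%E.
  rewrite /w ge0_integralZl_EFin ?powR_ge0//.
  - rewrite -integral_mkcondr -slabE -mu_gE EFinM.
    by rewrite lee_pmul2l ?fin_numE// ?Dle// lte_fin powR_gt0.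
  - move=> x _; rewrite /patch; case: ifP => // _; by rewrite lee_fin.
  - apply: measurable_funTS; apply/(measurable_restrictT _ _).1.
      exact: measurable_strip.
    exact: measurable_density.
apply: (@le_trans _ _ (\sum_(k < K.+2) (c k * (D * t k `^ eps))%:E)%E).
  by apply: lee_sum.
rewrite sumEFin lee_fin.
have -> : \sum_(k < K.+2) c k * (D * t k `^ eps) =
    D * 2 `^ d * (`|L| `^ (- eps) * \sum_(k < K.+2) (2 `^ (eps - d)) ^+ k).
  rewrite mulr_sumr mulr_sumr; apply: eq_bigr => k _.
  rewrite /c /t powRM ?invr_ge0 ?exprn_ge0//.
  have -> : (`|L|^-1) `^ eps = `|L| `^ (- eps).
    by rewrite -powR_inv1 ?(ltW L0)// -powRrM mulN1r.
  have E : 2 `^ (d - k%:R * d) * (2 ^+ k) `^ eps = 2 `^ d * (2 `^ (eps - d)) ^+ k.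
    exact: powR_geometric.
  transitivity (D * (2 `^ (d - k%:R * d) * (2 ^+ k) `^ eps) * `|L| `^ (- eps)).
    by ring.
  by rewrite E; ring.
apply: (@le_trans _ _ (D * 2 `^ d * (C * (`|L| `^ (- m) * fac)))).
  rewrite ler_wpM2l ?mulr_ge0 ?powR_ge0 ?(ltW D0)//.
  have := CP K `|L| (ltW L1) KL.
  by rewrite /fac /log_factor normr_id.
rewrite mulrDl ler_wpDl//.
  by rewrite !mulr_ge0 ?powR_ge0 ?invr_ge0 ?(ltW l20) ?(ltW fac0).
have -> : D * 2 `^ d * C * 2 `^ m * ((1 + `|L|) `^ (- m) * fac) =
    D * 2 `^ d * (C * (2 `^ m * (1 + `|L|) `^ (- m) * fac)) by ring.
rewrite ler_wpM2l ?mulr_ge0 ?powR_ge0 ?(ltW D0)// ler_wpM2l ?(ltW C0)//.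
by rewrite ler_wpM2r ?(ltW fac0)// pw// ltW.
Qed.

End slab_integral.

(** * From Fourier decay to slab bounds *)

Section fejer.
Variable R : realType.

Lemma cos_ge1B (x : R) : 1 - `|x| <= cos x.
Proof.
wlog x0 : x / 0 <= x.
  move=> H; have [x0|x0] := leP 0 x; first exact: H.
  by rewrite -cosN -normrN; apply: H; rewrite oppr_ge0 ltW.
have := @derive_dominated R cos id (fun s => - sin s) (fun=> 1) 0 x x0.
rewrite cos0 (ger0_norm x0) subr0 => H.
have : `|cos x - 1| <= x.
  apply: H => s _; rewrite normrN.
  by rewrite ler_norml sin_geN1 sin_le1.
by rewrite ler_norml => /andP[+ _]; rewrite lerBrDr addrC.
Qed.

(** Both sides are |sum_j e^(i j x)|^2; the right-hand side exhibits the kernel as nonnegative. *)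
Lemma fejer_sum (N : nat) (x : R) :
  \sum_(j < N) \sum_(k < N) cos ((j%:R - k%:R) * x) =
  (\sum_(j < N) cos (j%:R * x)) ^+ 2 + (\sum_(j < N) sin (j%:R * x)) ^+ 2.
Proof.
rewrite !expr2 !mulr_suml -big_split; apply: eq_bigr => j _ /=.
rewrite !mulr_sumr -big_split; apply: eq_bigr => k _ /=.
by rewrite mulrBl cosB.
Qed.

Lemma fejer_ge0 (N : nat) (x : R) :
  0 <= \sum_(j < N) \sum_(k < N) cos ((j%:R - k%:R) * x).
Proof. by rewrite fejer_sum addr_ge0// sqr_ge0. Qed.

(** For j < N the angle j x is at most 1 / 2 in absolute value, so each cosine in the first square
    is at least 1 / 2. *)
Lemma fejer_ge (N : nat) (x : R) : `|x| * (2 * N%:R) <= 1 ->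
  (N%:R / 2) ^+ 2 <= \sum_(j < N) \sum_(k < N) cos ((j%:R - k%:R) * x).
Proof.
move=> xN; rewrite fejer_sum ler_wpDr ?sqr_ge0//.
have : N%:R / 2 <= \sum_(j < N) cos (j%:R * x).
  have -> : (N%:R / 2 : R) = \sum_(j < N) (2^-1 : R).
    by rewrite sumr_const card_ord mulr_natl.
  apply: ler_sum => j _; apply: (le_trans _ (cos_ge1B _)).
  rewrite normrM ger0_norm//.
  have : (j%:R : R) * `|x| <= N%:R * `|x| by rewrite ler_wpM2r// ler_nat ltnW.
  by lra.
by move=> H; rewrite lerXn2r ?nnegrE// ?divr_ge0// (le_trans _ H)// divr_ge0.
Qed.

Variable eta : R.
Hypothesis eta01 : 0 < eta < 1.

Let h (m : nat) : R := (1 + m%:R) `^ (- eta).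

(** Comparison with the integral of x^(-eta): by the mean value theorem for x^(1 - eta) on
    [N, N + 1], the new term is at most the increment of the right-hand side. *)
Lemma powR_sum_le (N : nat) :
  \sum_(m < N) (1 + m%:R) `^ (- eta) <= N%:R `^ (1 - eta) / (1 - eta).
Proof.
have /andP[e0 e1] := eta01; have e1' : 0 < 1 - eta by rewrite subr_gt0.
elim: N => [|N IH]; first by rewrite big_ord0 divr_ge0 ?powR_ge0 ?ltW.
rewrite big_ord_recr /=; apply: (le_trans (lerD IH (lexx _))).
rewrite -lerBrDl -mulrBl ler_pdivlMr// -natr1 [1 + _]addrC.
(* The function x^(1 - eta) is not differentiable at 0, so the first step is checked directly. *)
have [->|N0] := posnP N.
  rewrite add0r !powR1 powR0 ?gt_eqF// subr0 mul1r; lra.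
have n0 : 0 < N%:R :> R by rewrite ltr0n.
have [||c /andP[c1 c2] ->] := @MVT_real R (fun x => x `^ (1 - eta))
    (fun x => (1 - eta) * x `^ (1 - eta - 1)) N%:R (N%:R + 1).
- by rewrite lerDl.
- move=> s /andP[s1 _]; apply: is_derive1_powR; exact: lt_le_trans s1.
have -> : N%:R + 1 - N%:R = 1 :> R by ring.
rewrite mulr1 [leLHS]mulrC ler_wpM2l ?(ltW e1')//.
have -> : 1 - eta - 1 = - eta by ring.
have c0 : 0 < c by exact: lt_le_trans c1.
rewrite !powRN lef_pV2 ?posrE ?powR_gt0 ?addr_gt0//.
by rewrite ge0_ler_powR ?nnegrE ?(ltW e0) ?(ltW c0) ?addr_ge0 ?(ltW n0).
Qed.

(** Raising [N] by one adds a row and a column, each with sum at most that of [h] over the enlarged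
    range. *)
Lemma fejer_coef_sum (N : nat) :
  \sum_(j < N) \sum_(k < N) (1 + `|j%:R - k%:R|) `^ (- eta) <=
  2 * N%:R * \sum_(m < N) h m.
Proof.
have h0 m : 0 <= h m by exact: powR_ge0.
elim: N => [|N IH]; first by rewrite !big_ord0 mulr0.
have T : \sum_(k < N.+1) (1 + `|N%:R - k%:R|) `^ (- eta) = \sum_(m < N.+1) h m.
  rewrite (reindex_inj rev_ord_inj); apply: eq_bigr => k _ /=.
  have kN : (k <= N)%N by rewrite -ltnS.
  rewrite /h subSS (natrB R kN); congr ((_ + _) `^ _).
  by rewrite opprB addrC subrK ger0_norm.
have T0 : \sum_(m < N) h m <= \sum_(m < N.+1) h m.
  by rewrite big_ord_recr lerDl.
rewrite big_ord_recr /= T.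
under eq_bigr do rewrite big_ord_recr /=.
rewrite big_split /=.
have T1 : \sum_(j < N) (1 + `|j%:R - N%:R|) `^ (- eta) <= \sum_(m < N.+1) h m.
  rewrite -T big_ord_recr /= ler_wpDr ?powR_ge0//.
  by apply: ler_sum => j _; rewrite distrC.
apply: (le_trans (lerD (lerD IH T1) (lexx _))).
have H : 2 * N%:R * \sum_(m < N) h m <= 2 * N%:R * \sum_(m < N.+1) h m.
  by rewrite ler_wpM2l.
rewrite -natr1; lra.
Qed.

End fejer.

(** * A C^1 cutoff and the test function built on it *)

Section bump.
Variable R : realType.

Definition pospart (y : R) : R := Num.max 0 y.

Lemma pospart_continuous : continuous pospart.
Proof.
move=> y; apply: (@continuous_max _ _ (cst 0) id); [exact: cst_continuous|].
exact: cvg_id.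
Qed.

(** Squaring removes the corner at 0; there Caratheodory's criterion applies with [pospart] itself
    as slope function. *)
Lemma is_derive_pospart_sq (y : R) :
  is_derive y 1 (fun z => pospart z ^+ 2) (2 * pospart y).
Proof.
have [y0|y0|->] := ltgtP y 0.
- rewrite /pospart (max_l (ltW y0)) mulr0.
  apply: (near_eq_is_derive (f := cst 0)).
  near=> z; rewrite /pospart max_l ?expr0n//; apply: ltW; near: z.
  exact: lt_nbhsl.
- rewrite /pospart (max_r (ltW y0)).
  apply: (near_eq_is_derive (f := fun z : R => z * z)).
    near=> z; rewrite /pospart max_r ?expr2//; apply: ltW; near: z.
    exact: lt_nbhsr.
  have := is_derive1M (is_derive_id y 1) (is_derive_id y 1) => h.
  by apply: is_derive_eq h _; ring.
- rewrite /pospart maxxx mulr0; apply/is_derive1_caratheodory.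
  exists pospart; split; [|exact: pospart_continuous|by rewrite /pospart maxxx].
  move=> z; rewrite /pospart maxxx expr0n/= !subr0.
  by have [z0|z0] := leP 0 z; rewrite ?mul0r ?expr0n// expr2.
Unshelve. all: by end_near. Qed.

(** An explicit formula along an orbit is available for t > 0 only, as homogeneity is; positivity
    being an open condition, the derivatives agree as well. *)
Lemma C1_pos_of (u v dv : R -> R) :
  (forall t : R, 0 < t -> u t = v t) ->
  (forall t : R, 0 < t -> is_derive t 1 v (dv t)) ->
  (forall t : R, 0 < t -> {for t, continuous dv}) ->
  C1_pos u /\ forall t : R, 0 < t -> derive1 u t = dv t.
Proof.
move=> uv dvE cdv.
have du (t : R) : 0 < t -> is_derive t 1 u (dv t).
  move=> t0; apply: (near_eq_is_derive (f := v)); last exact: dvE.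
  by near=> z; rewrite uv//; near: z; exact: lt_nbhsr.
have duE (t : R) : 0 < t -> derive1 u t = dv t.
  by move=> t0; rewrite derive1E; have [_ ->] := du t t0.
split=> // t t0; split; first by have [] := du t t0.
rewrite /prop_for /continuous_at duE//; apply: cvg_trans (cdv t t0).
apply: near_eq_cvg; near=> z; rewrite duE//; near: z; exact: lt_nbhsr.
Unshelve. all: by end_near. Qed.

Lemma powR_continuous_gt0 (p t : R) : 0 < t -> {for t, continuous (fun s => s `^ p)}.
Proof.
move=> t0; apply: differentiable_continuous; apply/derivable1_diffP.
by have [] := is_derive1_powR p t0.
Qed.

End bump.

Section test_function.
Variables (R : realType) (n : nat) (a : 'I_n -> R).
Hypothesis a0 : forall j, 0 < a j.
Variables (rho : R) (g : Rn R n -> R).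
Hypotheses (g0 : forall x, 0 <= g x) (lg : locally_integrable_Rn g).
Hypothesis hg : mixed_homogeneous_off0 a rho g.

Definition sqnorm (x : Rn R n) : R := \sum_j tnth x j ^+ 2.

(** In the orbit derivative at t = 1, the factor t^rho contributes |rho| and the squared cutoff 2 *
    (2 * [hdim a]); the summand 1 keeps the constant at most 1. *)
Definition test_const : R := (1 + `|rho| + 4 * hdim a)^-1.

Definition test_real (x : Rn R n) : R :=
  test_const * g x * pospart (1 - sqnorm x) ^+ 2.

Definition test_fun (x : Rn R n) : R[i] := test_real x +i* 0.

Lemma sqnorm_ge0 x : 0 <= sqnorm x.
Proof. by apply: sumr_ge0 => j _; exact: sqr_ge0. Qed.

Lemma test_den : 1 <= 1 + `|rho| + 4 * hdim a.
Proof. by rewrite -addrA lerDl addr_ge0// mulr_ge0// hdim_ge0. Qed.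

Lemma test_const_gt0 : 0 < test_const.
Proof. by rewrite invr_gt0 (lt_le_trans _ test_den). Qed.

Lemma test_const_le1 : test_const <= 1.
Proof. by rewrite invf_le1 ?test_den// (lt_le_trans _ test_den). Qed.

Lemma pospart_sqnorm x : 0 <= pospart (1 - sqnorm x) <= 1.
Proof.
rewrite /pospart le_max lexx ge_max ler01/= lerBlDr lerDl; exact: sqnorm_ge0.
Qed.

Lemma test_real_ge0 x : 0 <= test_real x.
Proof. by rewrite mulr_ge0 ?sqr_ge0// mulr_ge0// ltW// test_const_gt0. Qed.

Lemma test_real_le x : test_real x <= g x.
Proof.
have /andP[p0 p1] := pospart_sqnorm x.
rewrite /test_real mulrAC ler_piMl//.
by rewrite mulr_ile1 ?sqr_ge0 ?test_const_le1 ?(ltW test_const_gt0)// expr_le1.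
Qed.

Lemma test_real_supp x : 1 < sqnorm x -> test_real x = 0.
Proof.
by move=> x1; rewrite /test_real /pospart max_l ?expr0n ?mulr0// subr_le0 ltW.
Qed.

Lemma test_real_cube x : ~ cube x -> test_real x = 0.
Proof.
move=> xc; apply: test_real_supp.
have [j xj] : exists j, 1 < `|tnth x j|.
  apply: contrapT => H; apply: xc => j; rewrite -ler_norml leNgt.
  by apply/negP => xj; apply: H; exists j.
rewrite /sqnorm (bigD1 j)//= ltr_wpDr ?sumr_ge0//; first by move=> k _; exact: sqr_ge0.
by rewrite -[ltRHS]real_normK ?num_real// exprn_egt1.
Qed.

Lemma measurable_sqnorm : measurable_fun setT sqnorm.
Proof.
by apply: measurable_sum => j; apply: measurable_funX; exact: measurable_tnth_Rn.
Qed.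

Lemma measurable_test_real : measurable_fun setT test_real.
Proof.
apply: measurable_funM.
  by apply: measurable_funM; [exact: measurable_cst|exact: lg.1].
apply: measurable_funX.
apply: (measurableT_comp (continuous_measurable_fun (@pospart_continuous R))).
apply: measurable_funB; [exact: measurable_cst|exact: measurable_sqnorm].
Qed.

Lemma integrable_test_real : (@leb R n).-integrable setT (EFin \o test_real).
Proof.
have ig := (integrable_mkcond _ (@measurable_cube R n)).1 (mu_cube_integrable lg).
apply: (le_integrable measurableT _ _ ig).
  by apply/measurable_EFinP; exact: measurable_test_real.
move=> x _; rewrite /patch; case: ifPn => [_|]; last first.
  by rewrite notin_setE /= => xc; rewrite test_real_cube.
by rewrite /= lee_fin !ger0_norm ?test_real_ge0// test_real_le.
Qed.

(** Along an orbit [g] enters only through t^rho, so the test function is there an explicit function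
    of t. *)
Lemma test_orbit x : x <> @origin R n ->
  C1_pos (fun t => test_real (dil a t x)) /\
  `|derive1 (fun t => test_real (dil a t x)) 1| <= g x.
Proof.
move=> x0.
pose r (t : R) := \sum_j (t `^ (a j)^-1 * tnth x j) * (t `^ (a j)^-1 * tnth x j).
pose dj (t : R) j := (a j)^-1 * t `^ ((a j)^-1 - 1) * tnth x j.
pose dr (t : R) := \sum_j (dj t j * (t `^ (a j)^-1 * tnth x j) +
  (t `^ (a j)^-1 * tnth x j) * dj t j).
pose B (t : R) := pospart (1 - r t).
pose v (t : R) := test_const * g x * (t `^ rho * (B t) ^+ 2).
pose dv (t : R) := test_const * g x * (rho * t `^ (rho - 1) * (B t) ^+ 2 +
  t `^ rho * (2 * B t * (- dr t))).
have drE (t : R) : 0 < t -> is_derive t 1 r (dr t).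
  move=> t0; apply: is_derive1_sum => j.
  have h : is_derive t 1 (fun t => t `^ (a j)^-1 * tnth x j) (dj t j).
    have := is_derive1M (is_derive1_powR (a j)^-1 t0) (is_derive_cst (tnth x j) t 1).
    by move=> h; apply: is_derive_eq h _; rewrite /cst mulr0 addr0.
  exact: is_derive1M.
have rE (t : R) : sqnorm (dil a t x) = r t.
  by apply: eq_bigr => j _; rewrite tnth_dil expr2.
have drN (t : R) : 0 < t -> is_derive t 1 (fun t => 1 - r t) (- dr t).
  move=> t0; have := is_derive1D (is_derive_cst (1:R) t 1) (is_derive1Z (-1) (drE t t0)).
  rewrite (_ : (fun s => _) = (fun t => 1 - r t)); last first.
    by apply/funext => s; rewrite mulN1r.
  by move=> h; apply: is_derive_eq h _; rewrite add0r mulN1r.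
have [] := @C1_pos_of R (fun t => test_real (dil a t x)) v dv.
- move=> t t0; rewrite /test_real /v hg// rE /B; ring.
- move=> t t0; apply: is_derive1Z.
  apply: is_derive1M; first exact: is_derive1_powR.
  have := @is_derive1_comp R (fun z => pospart z ^+ 2) (fun t => 1 - r t) t _ _
    (is_derive_pospart_sq _) (drN t t0).
  by move=> h2; apply: is_derive_eq h2 _; rewrite /GRing.scale/= mulrC.
- move=> t t0.
  have cp p : (fun s : R => s `^ p) @ t --> t `^ p by exact: powR_continuous_gt0.
  have cB : B @ t --> B t.
    apply: (@continuous_comp _ _ _ (fun t => 1 - r t) (@pospart R)); last first.
      exact: pospart_continuous.
    apply: differentiable_continuous; apply/derivable1_diffP.
    by have [] := drN t t0.
  have cdj j : dj ^~ j @ t --> dj t j.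
    by apply: cvgM; [apply: cvgM => //; exact: cvg_cst|exact: cvg_cst].
  have ctj j : (fun s : R => s `^ (a j)^-1 * tnth x j) @ t --> t `^ (a j)^-1 * tnth x j.
    by apply: cvgM => //; exact: cvg_cst.
  have cdr : dr @ t --> dr t.
    apply: cvg_big => [|j _]; first exact: add_continuous.
    by apply: cvgD; exact: cvgM.
  apply: cvgM; first exact: cvg_cst.
  apply: cvgD.
    apply: cvgM; first by apply: cvgM => //; exact: cvg_cst.
    by under eq_fun do rewrite expr2; rewrite expr2; exact: cvgM.
  apply: cvgM => //; apply: cvgM; last exact: cvgN.
  by apply: cvgM => //; exact: cvg_cst.
move=> c1 dE; split => //.
rewrite dE// /dv !powR1 mul1r mulr1 normrM.
have r1 : r 1 = sqnorm x by rewrite -rE dil1.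
have /andP[B0 B1] : 0 <= B 1 <= 1 by rewrite /B r1; exact: pospart_sqnorm.
have dr1 : dr 1 = \sum_j 2 * ((a j)^-1 * tnth x j ^+ 2).
  by apply: eq_bigr => j _; rewrite /dj !powR1; ring.
(* Outside the unit ball [B 1] vanishes; inside, x_j^2 <= 1 bounds [dr 1], which is 2 * sum_j x_j^2
   / a_j. *)
have Bdr : `|B 1 * dr 1| <= 2 * hdim a.
  have [x1|x1] := ltP 1 (r 1).
    rewrite /B /pospart max_l ?mul0r ?normr0; last by rewrite subr_le0 ltW.
    by rewrite mulr_ge0// hdim_ge0.
  have dr0 : 0 <= dr 1.
    rewrite dr1; apply: sumr_ge0 => j _.
    by rewrite mulr_ge0// mulr_ge0 ?sqr_ge0// invr_ge0 ltW.
  rewrite normrM !ger0_norm// -[leRHS]mul1r ler_pM// dr1 mulr_sumr.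
  apply: ler_sum => j _; rewrite ler_wpM2l// ler_piMr ?invr_ge0 ?(ltW (a0 j))//.
  rewrite (le_trans _ x1)// r1 /sqnorm (bigD1 j)//= lerDl.
  by apply: sumr_ge0 => k _; exact: sqr_ge0.
rewrite normrM (ger0_norm (ltW test_const_gt0)) (ger0_norm (g0 x)).
rewrite mulrAC ler_piMl// /test_const mulrC ler_pdivrMr; last first.
  by rewrite (lt_le_trans _ test_den).
rewrite mul1r; apply: (le_trans (ler_normD _ _)).
have H1 : `|rho * B 1 ^+ 2| <= `|rho|.
  by rewrite normrM ler_piMr// ger0_norm ?sqr_ge0// expr_le1.
have -> : 2 * B 1 * - dr 1 = - (2 * (B 1 * dr 1)) by ring.
rewrite normrN [X in _ + X <= _]normrM [ `|2| ]ger0_norm//.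
lra.
Qed.

End test_function.

(** * Testing the Fourier decay against a Fejer-type kernel *)

Section converse.
Variables (R : realType) (n : nat) (a : 'I_n -> R).
Hypothesis a0 : forall j, 0 < a j.
Variables (rho : R) (g : Rn R n -> R).
Hypotheses (g0 : forall x, 0 <= g x) (lg : locally_integrable_Rn g).
Hypothesis hg : mixed_homogeneous_off0 a rho g.

Local Notation p := (test_real a rho g).

Lemma cabs_real (x : R) : cabs (x +i* 0) = `|x|.
Proof. by rewrite /cabs /= expr0n addr0 sqrtr_sqr. Qed.

Lemma test_admissible : admissible a g (test_fun a rho g).
Proof.
split.
- split; first exact: integrable_test_real.
  exact: integrable0.
- by move=> x x1; rewrite /test_fun test_real_supp.
- move=> x x0; split; first exact: (test_orbit a0 g0 hg x0).1.
  have [] := @C1_pos_of R (fun=> 0) (cst 0) (cst 0) => // t _.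
  exact: cst_continuous.
move=> x x0; rewrite cabs_real ger0_norm ?test_real_ge0// test_real_le//; split=> //.
rewrite /euler_derivative [X in _ +i* X](_ : _ = 0); last first.
  by rewrite derive1E; exact: derive_cst.
by rewrite cabs_real; exact: (test_orbit a0 g0 hg x0).2.
Qed.

Variable (i : 'I_n).

Lemma phase_single (f : Rn R n -> R) (m : R) x :
  phase f 0 (fun j => if j == i then m else 0) x = m * tnth x i.
Proof.
rewrite /phase mul0r add0r (bigD1 i)//= eqxx big1 ?addr0// => j /negbTE ->.
by rewrite mul0r.
Qed.

Lemma integrable_cos_test m :
  (@leb R n).-integrable setT (EFin \o (fun x => cos (m * tnth x i) * p x)).
Proof.
have := integrable_osc 0 (fun j => if j == i then m else 0) 0
  (measurable_cst (0:R)) (integrable_test_real a0 rho g0 lg).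
rewrite (_ : (fun x => _) = (fun x => cos (m * tnth x i) * p x))//.
by apply/funext => x; rewrite addr0 phase_single.
Qed.

Lemma Re_osc_integral_test (f : Rn R n -> R) m :
  complex.Re (osc_integral f (test_fun a rho g) 0 (fun j => if j == i then m else 0)) =
  Rintegral (@leb R n) setT (fun x => cos (m * tnth x i) * p x).
Proof.
apply: eq_Rintegral => x _.
have E := phase_single f m x; rewrite /phase in E.
by rewrite E /= mulr0 subr0.
Qed.

(** For |x|^2 <= 1 / 2 the squared cutoff is at least 1 / 4; the width 1 / (2 N) is the range of
    [fejer_ge]. *)
Definition strip_ball (N : nat) : set (Rn R n) :=
  [set x | sqnorm x <= 2^-1 /\ `|tnth x i| < (2 * N%:R)^-1].

Lemma measurable_strip_ball N : measurable (strip_ball N).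
Proof.
rewrite (_ : strip_ball N = (@sqnorm R n @^-1` `]-oo, 2^-1]) `&`
    [set x : Rn R n | `|tnth x i| < (2 * N%:R)^-1]).
  apply: measurableI; last exact: measurable_strip.
  rewrite -[X in measurable X]setTI.
  by apply: measurable_sqnorm => //; exact: measurable_itv.
by apply/seteqP; split => x /=; rewrite in_itv.
Qed.

(** The decay is used at the frequencies j - k in direction [i]. Summed over j, k < N it gives order
    N^(2 - eta), while the kernel is of order N^2 on the strip. *)
Lemma strip_ball_integral (f : Rn R n -> R) (eta F : R) : 0 < eta < 1 -> 0 < F ->
  (forall lam : 'I_n -> R, cabs (osc_integral f (test_fun a rho g) 0 lam) <=
     F * (1 + `|lam i|) `^ (- eta)) ->
  exists2 C : R, 0 < C & forall N, (0 < N)%N ->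
    (\int[@leb R n]_(x in strip_ball N) (g x)%:E <= (C * N%:R `^ (- eta))%:E)%E.
Proof.
move=> eta01 F0 HF; have /andP[e0 e1] := eta01.
have c0 := test_const_gt0 a0 rho.
set c := test_const a rho in c0.
(* The upper bound F * 2 N * N^(1 - eta) / (1 - eta) divided by the lower factor c N^2 / 16. *)
exists (F * 32 / (c * (1 - eta))).
  by rewrite !mulr_gt0// invr_gt0 mulr_gt0// subr_gt0.
move=> N N0; have n0 : 0 < N%:R :> R by rewrite ltr0n.
pose K x := \sum_(j < N) \sum_(k < N) cos ((j%:R - k%:R) * x) : R.
pose w (j k : 'I_N) x := (cos ((j%:R - k%:R) * tnth x i) * p x)%:E.
have iw j k : (@leb R n).-integrable setT (w j k) by exact: integrable_cos_test.
have wle j k : (\int[@leb R n]_x w j k x <= (F * (1 + `|j%:R - k%:R|) `^ (- eta))%:E)%E.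
  rewrite -(fineK (integrable_fin_num measurableT (iw j k))) lee_fin.
  rewrite -[X in X <= _]/(Rintegral (@leb R n) setT
    (fun x => cos ((j%:R - k%:R) * tnth x i) * p x)).
  rewrite -(Re_osc_integral_test f) (le_trans (ler_norm _))//.
  rewrite (le_trans (cabs_Re _))// (le_trans (HF _))// eqxx//.
have iK : (@leb R n).-integrable setT (fun x => \sum_(j < N) \sum_(k < N) w j k x)%E.
  by apply: integrable_sum => // j _; exact: integrable_sum.
have KE x : (\sum_(j < N) \sum_(k < N) w j k x = (K (tnth x i) * p x)%:E)%E.
  rewrite /K mulr_suml -sumEFin; apply: eq_bigr => j _.
  by rewrite mulr_suml -sumEFin.
have up : (\int[@leb R n]_x (K (tnth x i) * p x)%:E <=
    (F * (2 * N%:R * (N%:R `^ (1 - eta) / (1 - eta))))%:E)%E.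
  under eq_integral do rewrite -KE.
  rewrite integral_sum//; last by move=> j; exact: integrable_sum.
  apply: (@le_trans _ _ (\sum_(j < N) \sum_(k < N)
      (F * (1 + `|j%:R - k%:R|) `^ (- eta))%:E)%E).
    by apply: lee_sum => j _; rewrite integral_sum//; apply: lee_sum.
  under eq_bigr do rewrite sumEFin -mulr_sumr.
  rewrite sumEFin -mulr_sumr lee_fin ler_wpM2l ?(ltW F0)//.
  apply: (le_trans (fejer_coef_sum eta N)); rewrite ler_wpM2l ?mulr_ge0//.
  exact: powR_sum_le.
have mS := measurable_strip_ball N.
have K0 y : 0 <= K y by exact: fejer_ge0.
have p0 x : 0 <= p x by exact: test_real_ge0.
pose q := (N%:R / 2) ^+ 2 * (c / 4).
have q0 : 0 < q.
  by apply: mulr_gt0; [apply: exprn_gt0; exact: divr_gt0|exact: divr_gt0].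
have mK : measurable_fun setT (fun x : Rn R n => (K (tnth x i) * p x)%:E).
  have := measurable_int _ iK; apply: eq_measurable_fun => x _; exact: KE.
have low : (q%:E * \int[@leb R n]_(x in strip_ball N) (g x)%:E <=
    \int[@leb R n]_x (K (tnth x i) * p x)%:E)%E.
  rewrite -(ge0_integralZl_real mS lg.1 g0 (ltW q0)).
  apply: (@le_trans _ _ (\int[@leb R n]_(x in strip_ball N) (K (tnth x i) * p x)%:E)%E).
    apply: ge0_le_integral.
    - exact: mS.
    - by move=> x _; rewrite -EFinM lee_fin mulr_ge0// ltW.
    - apply: measurable_funeM; exact: measurable_density.
    - exact: measurable_funTS mK.
    - move=> x [xs xi]; rewrite -EFinM lee_fin /q -mulrA ler_pM//.
      + by rewrite mulr_ge0// divr_ge0// ltW.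
      + apply: fejer_ge; rewrite -ler_pdivlMr ?mulr_gt0// div1r; exact: ltW.
      + rewrite mulrAC /test_real -/c ler_wpM2l//.
          by rewrite mulr_ge0// ltW.
        have -> : 4^-1 = (2^-1) ^+ 2 :> R by field.
        rewrite lerXn2r ?nnegrE ?invr_ge0//.
          by have /andP[] := pospart_sqnorm x.
        by rewrite /pospart le_max; apply/orP; right; lra.
  apply: ge0_subset_integral.
  - exact: mS.
  - exact: measurableT.
  - exact: mK.
  - by move=> x _; rewrite lee_fin mulr_ge0.
  - by [].
have := le_trans low up; rewrite -lee_pdivlMl// -EFinM => /le_trans; apply.
rewrite lee_fin /q le_eqVlt; apply/orP; left; apply/eqP.
have -> : N%:R `^ (1 - eta) = N%:R * N%:R `^ (- eta) :> R.
  by rewrite powRD ?powRr1 ?(ltW n0)// (gt_eqF n0) implybT.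
have e1' : 1 - eta != 0 by rewrite gt_eqF// subr_gt0.
have n0' : N%:R != 0 :> R by rewrite gt_eqF.
have c0' : c != 0 by rewrite gt_eqF.
move: (N%:R `^ (- eta)) e1' n0' => X; move: (1 - eta) => e' e1'.
move: (N%:R) => M M0; field; by rewrite e1' M0 c0'.
Qed.

End converse.

(** * Transfer from the ball to the cube by a fixed dilation *)

Section slab_from_fourier.
Variables (R : realType) (n : nat) (a : 'I_n -> R).
Hypothesis n1 : (1 <= n)%N.
Hypothesis a0 : forall j, 0 < a j.
Variables (rho : R) (g : Rn R n -> R).
Hypotheses (g0 : forall x, 0 <= g x) (lg : locally_integrable_Rn g).
Hypothesis hg : mixed_homogeneous_off0 a rho g.
Variable i : 'I_n.

(** Here e^(s0) = (2 n)^(- sum_j a_j), so each coordinate shrinks by a factor of at most 1 / (2 n):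
    the cube lands in |x|^2 <= 1 / 2. *)
Let s0 : R := - ((\sum_j a j) * ln (2 * n%:R)).

Lemma dil_slab_strip_ball N t x : t <= (2 * N%:R)^-1 -> slab i t x ->
  strip_ball i N (dil a (expR s0) x).
Proof.
move=> tN [xc xt].
have n0 : 0 < n%:R :> R by rewrite ltr0n.
have n2 : 1 <= 2 * n%:R :> R by rewrite -natrM ler1n muln_gt0.
have ln0 : 0 <= ln (2 * n%:R) :> R by exact: ln_ge0.
have sj j : expR ((a j)^-1 * s0) <= (2 * n%:R)^-1.
  rewrite -[X in _ <= X^-1]lnK ?posrE ?mulr_gt0// -expRN ler_expR /s0 mulrN lerN2.
  rewrite mulrA ler_peMl// mulrC ler_pdivlMr// mul1r.
  by rewrite (bigD1 j)//= lerDl; apply: sumr_ge0 => k _; exact: ltW.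
have n21 : (2 * n%:R)^-1 <= 1 :> R by rewrite invf_le1// (lt_le_trans _ n2).
split.
  rewrite /sqnorm.
  have -> : 2^-1 = \sum_(j < n) (2 * n%:R)^-1 :> R.
    rewrite sumr_const card_ord -[RHS]mulr_natl invfM mulrCA divff ?mulr1//.
    by rewrite gt_eqF.
  apply: ler_sum => j _; rewrite tnth_dil_expR exprMn.
  rewrite -[leRHS]mulr1 ler_pM ?sqr_ge0//.
    rewrite expr2 -[leRHS]mulr1 ler_pM ?expR_ge0// (le_trans (sj j))//.
  by rewrite -real_normK ?num_real// expr_le1// ler_norml; exact: xc.
rewrite tnth_dil_expR normrM (ger0_norm (expR_ge0 _)) (lt_le_trans _ tN)//.
apply: le_lt_trans xt; rewrite ler_piMl// (le_trans (sj i))//.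
Qed.

(** The dilation by e^(s0) maps the slab into the strip; the constant combines its Jacobian with the
    factor e^(rho s0) gained by [g]. *)
Lemma mu_slab_le_strip_ball N t : t <= (2 * N%:R)^-1 ->
  (mu_g g (slab i t) <= (expR (rho * s0) * expR (hdim a * s0))^-1%:E *
     \int[@leb R n]_(x in strip_ball i N) (g x)%:E)%E.
Proof.
move=> tN; have [j0 Hyp0] := leb_hyperplane R n1.
set Hyp := [set x | _] in Hyp0.
have mH : measurable Hyp.
  rewrite -[X in measurable X]setTI.
  by apply: (@measurable_tnth_Rn R n j0 measurableT [set 0]); exact: measurable_set1.
have mS := @measurable_slab R n i t.
have mB := measurable_strip_ball i N : measurable (strip_ball i N : set (Rn R n)).
pose D := slab i t `\` Hyp.
have mD : measurable D by exact: measurableD.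
have Dx0 x : D x -> x <> @origin R n.
  by move=> [_ xH] x0; apply: xH; rewrite x0 /Hyp /= tnth_mktuple.
pose r j := expR s0 `^ (a j)^-1.
have r0 j : 0 < r j by rewrite powR_gt0 ?expR_gt0.
have rE : \prod_j r j = expR (hdim a * s0).
  rewrite /hdim mulr_suml expR_sum; apply: eq_bigr => j _.
  by rewrite /r powR_expR ?expR_gt0// expRK.
pose h := (fun x : Rn R n => (g x)%:E) \_ (strip_ball i N).
have h0 x : (0 <= h x)%E by rewrite /h /patch; case: ifP; rewrite lee_fin.
have mh : measurable_fun setT h.
  by apply/(measurable_restrictT _ mB).1; exact: measurable_density.
have kap0 : 0 < expR (rho * s0) * expR (hdim a * s0) by rewrite mulr_gt0// expR_gt0.
rewrite lee_pdivlMl// mulrC EFinM -muleA.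
rewrite [X in (_ <= X)%E]integral_mkcond -/h (ge0_integral_tscale r0 mh h0) rE.
rewrite lee_pmul2l ?fin_numE// ?lte_fin ?expR_gt0//.
have -> : mu_g g (slab i t) = (\int[@leb R n]_(x in D) (g x)%:E)%E.
  rewrite mu_gE//; apply: ge0_negligible_integral.
  - exact: mH.
  - exact: mS.
  - exact: measurable_density.
  - by move=> x _; rewrite lee_fin.
  - exact: Hyp0.
rewrite -(ge0_integralZl_real mD lg.1 g0 (expR_ge0 _)).
have mhS : measurable_fun setT (fun x : Rn R n => h (tscale r x)).
  exact: (measurableT_comp mh (measurable_tscale_Rn r0)).
apply: (@le_trans _ _ (\int[@leb R n]_(x in D) h (tscale r x))%E).
  apply: ge0_le_integral.
  - exact: mD.
  - by move=> x _; rewrite -EFinM lee_fin mulr_ge0// expR_ge0.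
  - by apply: measurable_funeM; exact: measurable_density.
  - exact: measurable_funTS mhS.
  - move=> x Dx; have xB := dil_slab_strip_ball tN Dx.1.
    rewrite /h /patch (mem_set xB) -EFinM lee_fin.
    rewrite -[tscale r x]/(dil a (expR s0) x) hg ?expR_gt0//; last exact: Dx0.
    by rewrite powR_expR ?expR_gt0// expRK.
apply: ge0_subset_integral.
- exact: mD.
- exact: measurableT.
- exact: mhS.
- by move=> x _; exact: h0.
- by [].
Qed.

Lemma slab_of_fourier_decay (f : Rn R n -> R) (eta F eps : R) :
  0 < eta < 1 -> 0 < F -> 0 < eps < eta ->
  (forall phi, admissible a g phi -> forall lam : 'I_n -> R,
     cabs (osc_integral f phi 0 lam) <= F * (1 + `|lam i|) `^ (- eta)) ->
  exists2 E : R, 0 < E &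
    forall t : R, 0 < t -> (mu_g g (slab i t) <= (E * t `^ eps)%:E)%E.
Proof.
move=> eta01 F0 /andP[e0 ee] H; have /andP[eta0 eta1] := eta01.
have [C C0 CP] := strip_ball_integral a0 g0 lg eta01 F0
  (H _ (test_admissible a0 g0 lg hg)).
have Mfin : mu_g g (@cube R n) \is a fin_num.
  by rewrite ge0_fin_numE ?mu_g_ge0// mu_cube_lty.
set M := fine (mu_g g (@cube R n)).
have M0 : 0 <= M by rewrite fine_ge0// mu_g_ge0.
set kap := (expR (rho * s0) * expR (hdim a * s0))^-1.
have kap0 : 0 < kap by rewrite invr_gt0 mulr_gt0 ?expR_gt0.
(* The first summand serves t >= 1 / 2, where the mass of the cube suffices; the second serves t < 1
   / 2. *)
exists (M * 2 `^ eps + kap * C * 4 `^ eta).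
  by rewrite ltr_wpDl ?mulr_ge0 ?powR_ge0// !mulr_gt0// powR_gt0.
move=> t t0.
have [t2|t2] := leP 2^-1 t.
  apply: (le_trans (mu_g_subset g0 lg (measurable_slab i t)
    (@measurable_cube R n) (@slab_cube _ _ _ _))).
  rewrite -(fineK Mfin) lee_fin -/M mulrDl ler_wpDr//.
    by rewrite !mulr_ge0 ?powR_ge0// ltW.
  rewrite -mulrA ler_peMr// -powRM ?(ltW t0)//.
  have := @ge0_ler_powR R eps (ltW e0) 1 (2 * t).
  rewrite powR1 !nnegrE ler01 mulr_ge0 ?(ltW t0)// => H1; apply: H1 => //; lra.
have T1 : 1 <= (2 * t)^-1 by rewrite invf_ge1 ?mulr_gt0//; lra.
have /andP[N1 N2] := truncn_itv (le_trans ler01 T1).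
(* With N the integer part of 1 / (2 t), both t <= 1 / (2 N) and N >= 1 / (4 t) hold. Hence N^(-eta)
   <= (4 t)^eta, which is at most 4^eta t^eps because t < 1. *)
set N := Num.truncn _ in N1 N2.
have N0 : (0 < N)%N by have := le_lt_trans T1 N2; rewrite ltr1n ltnS.
have n0 : 0 < N%:R :> R by rewrite ltr0n.
have n1' : 1 <= N%:R :> R by rewrite ler1n.
have tN : t <= (2 * N%:R)^-1.
  rewrite -[t]invrK lef_pV2 ?posrE ?mulr_gt0 ?invr_gt0//.
  by rewrite -ler_pdivlMl// -invfM.
have Nt : (4 * t)^-1 <= N%:R.
  have -> : (4 * t)^-1 = 2^-1 * (2 * t)^-1.
    by rewrite -invfM mulrA; congr (_ * _)^-1; ring.
  by move: N2 n1'; rewrite -(natr1 N); move: (N%:R) ((2 * t)^-1) => u w; lra.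
apply: (le_trans (mu_slab_le_strip_ball tN)); rewrite -/kap.
apply: (@le_trans _ _ (kap%:E * (C * N%:R `^ (- eta))%:E)%E).
  by rewrite lee_pmul2l ?fin_numE ?lte_fin// CP.
rewrite -EFinM lee_fin mulrDl ler_wpDl ?mulr_ge0 ?powR_ge0//.
rewrite -!mulrA ler_wpM2l ?(ltW kap0)// ler_wpM2l ?(ltW C0)//.
apply: (@le_trans _ _ ((4 * t) `^ eta)).
  have X0 : 0 < (4 * t)^-1 by rewrite invr_gt0 mulr_gt0.
  have -> : (4 * t) `^ eta = (4 * t)^-1 `^ (- eta).
    by rewrite -powR_inv1 ?mulr_ge0 ?(ltW t0)// -powRrM mulN1r opprK.
  rewrite !powRN lef_pV2 ?posrE ?powR_gt0//.
  by rewrite ge0_ler_powR ?nnegrE ?(ltW eta0) ?(ltW X0) ?(ltW n0).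
rewrite powRM ?(ltW t0)// ler_wpM2l ?powR_ge0//.
by rewrite ger_powR ?t0 ?(ltW ee)//; lra.
Qed.

End slab_from_fourier.

(** * The theorem *)

Lemma cabs_le_sum (R : realType) (z : R[i]) :
  cabs z <= `|complex.Re z| + `|complex.Im z|.
Proof.
case: z => x y; rewrite /cabs /=.
have H : 0 <= `|x| + `|y| by rewrite addr_ge0.
rewrite -[leRHS](ger0_norm H) -sqrtr_sqr ler_wsqrtr//.
rewrite sqrrD !real_normK ?num_real// lerD2r lerDl mulrn_wge0// mulr_ge0//.
Qed.

Section decay_of_slab.
Variables (R : realType) (n : nat) (a : 'I_n -> R).
Hypothesis n1 : (1 <= n)%N.
Hypothesis a0 : forall j, 0 < a j.
Variables (f : Rn R n -> R) (rho : R) (g : Rn R n -> R) (i : 'I_n).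
Hypotheses (mf : measurable_fun [set: Rn R n] f) (hf : mixed_homogeneous a f).
Hypotheses (g0 : forall x, 0 <= g x) (lg : locally_integrable_Rn g).
Hypothesis hg : mixed_homogeneous_off0 a rho g.

(** Re (e^(i theta) phi) = cos theta Re phi - sin theta Im phi, with the sine written as a shifted
    cosine to fit [osc_integral_decay]. *)
Lemma Re_osc_integral phi lam0 lam : admissible a g phi ->
  complex.Re (osc_integral f phi lam0 lam) =
  Rintegral (@leb R n) setT
    (fun x => cos (phase f lam0 lam x + 0) * complex.Re (phi x)) +
  Rintegral (@leb R n) setT
    (fun x => cos (phase f lam0 lam x + pi / 2) * complex.Im (phi x)).
Proof.
move=> [[iR iI] _ _ _]; rewrite -RintegralD//; last 2 first.
- exact: integrable_osc mf iR.
- exact: integrable_osc mf iI.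
apply: eq_Rintegral => x _; rewrite addr0 cosDpihalf.
by rewrite /= -/(phase f lam0 lam x); case: (phi x) => u w /=; rewrite mulNr.
Qed.

Lemma Im_osc_integral phi lam0 lam : admissible a g phi ->
  complex.Im (osc_integral f phi lam0 lam) =
  Rintegral (@leb R n) setT
    (fun x => cos (phase f lam0 lam x + 0) * complex.Im (phi x)) +
  Rintegral (@leb R n) setT
    (fun x => cos (phase f lam0 lam x + - (pi / 2)) * complex.Re (phi x)).
Proof.
move=> [[iR iI] _ _ _]; rewrite -RintegralD//; last 2 first.
- exact: integrable_osc mf iI.
- exact: integrable_osc mf iR.
apply: eq_Rintegral => x _; rewrite addr0 cosBpihalf.
by rewrite /= -/(phase f lam0 lam x); case: (phi x) => u w /=.
Qed.

Variable bs : seq R.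
Hypothesis ibs : (a i)^-1 \notin bs.
Hypothesis jbs : forall j, j != i -> (a j)^-1 \in bs.

(** One statement serves (a) and (b): a list [bs] containing 1 admits every [lam0], while for
    [lam0 = 0] a list shorter by one gives the better exponent. The 4 counts the cosine integrals in
    the real and imaginary parts. *)
Lemma osc_integral_le (eps D : R) : 0 < eps -> 0 < D ->
  (forall t, 0 < t -> (mu_g g (slab i t) <= (D * t `^ eps)%:E)%E) ->
  exists2 E : R, 0 < E & forall phi, admissible a g phi ->
    forall lam0 (lam : 'I_n -> R), (lam0 = 0 \/ 1 \in bs) ->
    cabs (osc_integral f phi lam0 lam) <=
      E * ((1 + `|lam i|) `^ (- Num.min eps (size bs).+1%:R^-1) *
        log_factor eps (size bs).+1%:R^-1 (lam i)).
Proof.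
move=> e0 D0 HD.
have d0 : 0 < ((size bs).+1%:R^-1 : R) by rewrite invr_gt0.
have [C C0 CP] := osc_integral_decay n1 a0 rho ibs jbs.
have [E E0 EP] := decay_integral_le g0 lg e0 d0 D0 HD.
exists (4 * (C * E)); first by rewrite !mulr_gt0.
move=> phi aphi lam0 lam lam0bs.
set B := _ * log_factor _ _ _.
have bound p c : orbit_admissible a g p ->
    `|Rintegral (@leb R n) setT (fun x => cos (phase f lam0 lam x + c) * p x)| <=
    C * (E * B).
  move=> ap; rewrite -lee_fin.
  apply: (le_trans (CP f g p lam0 lam c mf hf g0 lg hg ap lam0bs)).
  by rewrite [in leRHS]EFinM lee_pmul2l ?fin_numE ?lte_fin.
have aR := admissible_Re aphi; have aI := admissible_Im aphi.
apply: (le_trans (cabs_le_sum _)); rewrite Re_osc_integral// Im_osc_integral//.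
apply: (le_trans (lerD (ler_normD _ _) (ler_normD _ _))).
have -> : 4 * (C * E) * B =
    C * (E * B) + C * (E * B) + (C * (E * B) + C * (E * B)) by ring.
by rewrite !lerD ?bound.
Qed.

End decay_of_slab.

(** [bs] holds the inverses of the distinct values other than [a i], each once, so that repeated
    values do not raise the order of the van der Corput estimate. *)
Lemma distinct_exponents (R : realType) (n : nat) (a : 'I_n -> R) (i : 'I_n) :
  (forall j, j <> i -> a j <> a i) ->
  exists bs : seq R, [/\ (a i)^-1 \notin bs,
    forall j, j != i -> (a j)^-1 \in bs & (size bs).+1 = num_distinct a].
Proof.
move=> hi; pose s := undup [seq a j | j <- enum 'I_n].
have us : uniq s by exact: undup_uniq.
have sa j : a j \in s by rewrite mem_undup map_f// mem_enum.
exists [seq x^-1 | x <- rem (a i) s]; split.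
- by rewrite (mem_map invr_inj) mem_rem_uniq// inE eqxx.
- move=> j ji; rewrite (mem_map invr_inj) mem_rem_uniq// inE sa andbT.
  by apply/eqP; apply: hi; apply/eqP.
- rewrite size_map size_rem// prednK// /num_distinct -/s.
  by have := sa i; case: s {us sa}.
Qed.

Theorem theorem1p2 (R : realType) (n : nat) (hn : (1 <= n)%N)
    (a : 'I_n -> R) (ha0 : forall j, 0 < a j) (ha1 : forall j, a j <> 1)
    (f : Rn R n -> R) (mf : measurable_fun [set: Rn R n] f)
    (hf : mixed_homogeneous a f)
    (rho : R) (g : Rn R n -> R) (g0 : forall x, 0 <= g x)
    (lg : locally_integrable_Rn g) (hg : mixed_homogeneous_off0 a rho g)
    (i : 'I_n) (hi : forall j, j <> i -> a j <> a i) :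
  let v := num_distinct a in
  (forall eps : R, 0 < eps ->
    (exists2 D : R, 0 < D &
      forall t : R, 0 < t -> (mu_g g (slab i t) <= (D * t `^ eps)%:E)%E) ->
    [/\ eps <> v.+1%:R^-1 ->
          exists2 E : R, 0 < E &
            forall phi, admissible a g phi ->
            forall (lam0 : R) (lam : 'I_n -> R),
              cabs (osc_integral f phi lam0 lam) <=
                E * (1 + `|lam i|) `^ (- Num.min eps v.+1%:R^-1),
        eps = v.+1%:R^-1 ->
          exists2 E : R, 0 < E &
            forall phi, admissible a g phi ->
            forall (lam0 : R) (lam : 'I_n -> R),
              cabs (osc_integral f phi lam0 lam) <=
                E * (1 + `|lam i|) `^ (- Num.min eps v.+1%:R^-1)
                  * ln (2 + `|lam i|),
        eps <> v%:R^-1 ->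
          exists2 F : R, 0 < F &
            forall phi, admissible a g phi ->
            forall lam : 'I_n -> R,
              cabs (osc_integral f phi 0 lam) <=
                F * (1 + `|lam i|) `^ (- Num.min eps v%:R^-1) &
        eps = v%:R^-1 ->
          exists2 F : R, 0 < F &
            forall phi, admissible a g phi ->
            forall lam : 'I_n -> R,
              cabs (osc_integral f phi 0 lam) <=
                F * (1 + `|lam i|) `^ (- Num.min eps v%:R^-1)
                  * ln (2 + `|lam i|)]) /\
  (forall eta : R, 0 < eta < 1 ->
    (exists2 F : R, 0 < F &
      forall phi, admissible a g phi ->
      forall lam : 'I_n -> R,
        cabs (osc_integral f phi 0 lam) <= F * (1 + `|lam i|) `^ (- eta)) ->
    forall eps : R, 0 < eps < eta ->
      exists2 E : R, 0 < E &
        forall t : R, 0 < t -> (mu_g g (slab i t) <= (E * t `^ eps)%:E)%E).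
Proof.
move=> v; have [ds [ids jds dsv]] := distinct_exponents hi.
(* For (a) the exponent 1 of [f] joins the list, whose length becomes [v]; [ha1] keeps [(a i)^-1]
   out of it. For (b) the list [ds], of length [v] - 1, is used as it is. *)
have i1 : (a i)^-1 \notin 1 :: ds.
  rewrite inE negb_or ids andbT; apply/eqP => H; apply: (ha1 i).
  by rewrite -[a i]invrK H invr1.
have j1 j : j != i -> (a j)^-1 \in 1 :: ds.
  by move=> /jds H; rewrite inE H orbT.
split; last first.
  move=> eta eta01 [F F0 HF] eps he.
  exact: (slab_of_fourier_decay hn ha0 g0 lg hg eta01 F0 he HF).
move=> eps e0 [D D0 HD].
have [E E0 HE] := osc_integral_le hn ha0 mf hf g0 lg hg i1 j1 e0 D0 HD.
have [F F0 HF] := osc_integral_le hn ha0 mf hf g0 lg hg ids jds e0 D0 HD.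
rewrite /= dsv -/v in HE; rewrite dsv -/v in HF.
have one : 1 \in 1 :: ds by rewrite inE eqxx.
split=> [ev|ev|ev|ev].
- exists E => // phi aphi lam0 lam; have := HE phi aphi lam0 lam (or_intror one).
  by rewrite /log_factor ifN ?mulr1//; exact/eqP.
- exists E => // phi aphi lam0 lam; have := HE phi aphi lam0 lam (or_intror one).
  by rewrite /log_factor ev eqxx mulrA.
- exists F => // phi aphi lam; have := HF phi aphi 0 lam (or_introl erefl).
  by rewrite /log_factor ifN ?mulr1//; exact/eqP.
- exists F => // phi aphi lam; have := HF phi aphi 0 lam (or_introl erefl).
  by rewrite /log_factor ev eqxx mulrA.
Qed.
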